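(* Let $I\subseteq[d]$. The coordinate-average operators $\Pi_i$, $i\in[d]$, are bounded linear contractions on $L^p(S)$ for every $1\le p\le\infty$. They are idempotent and commute: $$\Pi_i^2=\Pi_i,\qquad \Pi_i\Pi_j=\Pi_j\Pi_i\qquad(i,j\in[d]).$$ Consequently, $\mathcal P_I$ and $\mathcal R_I$ are bounded linear projections (idempotent operators) on $L^p(S)$ for every $1\le p\le\infty$, and $$\mathcal P_I\mathcal R_I=\mathcal R_I\mathcal P_I=0.$$ Moreover, if $i\in I$, then $\Pi_i\mathcal P_I=0$, so $\mathcal P_I\varphi$ is centered on $I$ for every $\varphi\in L^1(S)$. For nonempty $I$ (and $\varphi\in L^1(S)$), $$\mathcal R_I\varphi=0\quad\Longleftrightarrow\quad \varphi\text{ is centered on }I.$$ Finally, if $\varphi\in W^{1,\infty}(S)$, then $\mathcal P_I\varphi,\mathcal R_I\varphi\in W^{1,\infty}(S)$.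
   Context: Let $d\ge 1$, $[d]=\{1,\dots,d\}$, and let $S=\prod_{i=1}^d[a_i,b_i]\subset\mathbb R^d$ be a box with $a_i<b_i$. For $i\in[d]$ write $\omega_{-i}=(\omega_j)_{j\ne i}$ and $S_{-i}=\prod_{j\ne i}[a_j,b_j]$. For $\varphi\in L^1(S)$ the coordinate-$i$ average operator is $$(\Pi_i\varphi)(\omega)=\frac1{b_i-a_i}\int_{a_i}^{b_i}\varphi(\omega_{-i},t)\,dt,$$ where $\varphi(\omega_{-i},t)$ means that $t$ is inserted in the $i$th coordinate; thus $\Pi_i\varphi$ is a function on $S$ that does not depend on $\omega_i$. A function $\varphi\in L^1(S)$ is centered in direction $i$ if $\Pi_i\varphi=0$ a.e. on $S$; it is centered on a nonempty set $I\subseteq[d]$ if it is centered in every direction $i\in I$. For $I\subseteq[d]$, $$\mathcal P_I=\prod_{i\in I}(\mathrm{Id}-\Pi_i),\qquad \mathcal P_\varnothing=\mathrm{Id},\qquad \mathcal R_I=\mathrm{Id}-\mathcal P_I.$$ *)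

(* Defs.v *)
From HB Require Import structures.
From mathcomp Require Import all_boot all_order all_algebra.
From mathcomp Require Import all_classical all_reals all_analysis.

Set Implicit Arguments.
Unset Strict Implicit.
Unset Printing Implicit Defensive.
Import Order.TTheory GRing.Theory Num.Theory.
Import numFieldNormedType.Exports.

Local Open Scope classical_set_scope.
Local Open Scope ring_scope.

(* ['rV[R]_n] carries the product sigma-algebra, generated by the coordinates,
   exactly as the library does for [n.-tuple]. *)
Definition rV_display : measure_display -> measure_display.
Proof. exact. Qed.

Section measurable_rV.
Context {d} {T : measurableType d} (n : nat).

Let coors : 'I_n -> 'rV[T]_n -> T := fun i x => x ord0 i.

Let rV_set0 : g_sigma_preimage coors set0.
Proof. exact: sigma_algebra0. Qed.

Let rV_setC A : g_sigma_preimage coors A -> g_sigma_preimage coors (~` A).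
Proof. exact: sigma_algebraC. Qed.

Let rV_bigcup (F : _^nat) : (forall i, g_sigma_preimage coors (F i)) ->
  g_sigma_preimage coors (\bigcup_i (F i)).
Proof. exact: sigma_algebra_bigcup. Qed.

HB.instance Definition _ := @isMeasurable.Build (rV_display d)
  'rV[T]_n (g_sigma_preimage coors) rV_set0 rV_setC rV_bigcup.

End measurable_rV.

Lemma measurable_coord d (T : measurableType d) n (i : 'I_n) :
  measurable_fun [set: 'rV[T]_n] (fun x => x ord0 i).
Proof.
move=> _ Y mY; rewrite setTI; apply: sub_sigma_algebra => /=.
rewrite -bigcup_seq/=; exists i => /=; first by rewrite mem_index_enum.
by exists Y => //; rewrite setTI.
Qed.

Lemma measurable_fun_coordP d1 d2 (T1 : measurableType d1)
    (T2 : measurableType d2) n (f : T1 -> 'rV[T2]_n) :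
  (forall i, measurable_fun [set: T1] (fun x => f x ord0 i)) ->
  measurable_fun [set: T1] f.
Proof.
move=> mf _ Y mY; rewrite setTI.
have : image_set_system setT f measurable Y; last first.
  by rewrite /image_set_system/= setTI.
apply: (smallest_sub _ _ mY).
  exact/sigma_algebra_image/sigma_algebra_measurable.
move=> A; rewrite -bigcup_seq/= => -[i _ [B mB <-]].
by rewrite /image_set_system/= !setTI; have := mf i measurableT B mB; rewrite setTI.
Qed.

Section lebesgue_rV.
Context {R : realType}.

Definition rV_cons n (p : R * 'rV[R]_n) : 'rV[R]_n.+1 :=
  \row_i (if unlift ord0 i is Some j then p.2 ord0 j else p.1).

Definition rV_uncons n (x : 'rV[R]_n.+1) : R * 'rV[R]_n :=
  (x ord0 ord0, \row_j x ord0 (lift ord0 j)).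

Lemma measurable_rV_cons n : measurable_fun setT (@rV_cons n).
Proof.
apply: measurable_fun_coordP => i; case: (unliftP ord0 i) => [j ->|->].
  rewrite [X in measurable_fun _ X](_ : _ = (fun y : 'rV[R]_n => y ord0 j) \o snd); last first.
    by apply/funext => p /=; rewrite mxE liftK.
  by apply: measurableT_comp => //; exact: measurable_coord.
rewrite [X in measurable_fun _ X](_ : _ = fst); first exact: measurable_fst.
by apply/funext => p /=; rewrite mxE unlift_none.
Qed.

Lemma measurable_rV_uncons n : measurable_fun setT (@rV_uncons n).
Proof.
apply/measurable_fun_pairP; split; first exact: measurable_coord.
apply: measurable_fun_coordP => i /=.
rewrite [X in measurable_fun _ X](_ : _ =
    (fun x : 'rV[R]_n.+1 => x ord0 (lift ord0 i))).
  exact: measurable_coord.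
by apply/funext => x; rewrite mxE.
Qed.

Lemma rV_consK n : cancel (@rV_cons n) (@rV_uncons n).
Proof.
move=> [t x]; congr pair; rewrite /= ?mxE ?unlift_none//.
by apply/rowP => j; rewrite !mxE liftK.
Qed.

Section lebesgue_rVS.
Variables (n : nat) (mu : {sigma_finite_measure set 'rV[R]_n -> \bar R}).

Definition lebesgue_rVS : set 'rV[R]_n.+1 -> \bar R :=
  pushforward (lebesgue_measure \x mu)%E (@rV_cons n).

Let nu : {measure set 'rV[R]_n.+1 -> \bar R} :=
  measure_function_pushforward__canonical__measure_function_Measure
    (lebesgue_measure \x mu)%E (@measurable_rV_cons n).

HB.instance Definition _ := isMeasure.Build _ _ _ lebesgue_rVS
  (measure0 nu) (measure_ge0 nu) (@measure_semi_sigma_additive _ _ _ nu).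

Lemma lebesgue_rVSE (A : set R) (B : set 'rV[R]_n) :
  measurable A -> measurable B ->
  lebesgue_rVS (@rV_uncons n @^-1` (A `*` B)) = (lebesgue_measure A * mu B)%E.
Proof.
move=> mA mB; rewrite /lebesgue_rVS /pushforward -comp_preimage.
rewrite (_ : _ \o _ = id); last by apply/funext => p /=; rewrite rV_consK.
by rewrite preimage_id product_measure1E.
Qed.

Let sigma_finite_lebesgue_rVS : sigma_finite setT lebesgue_rVS.
Proof.
have /sigma_finiteP[F [TF ndF Foo]] := sigma_finiteT (@lebesgue_measure R).
have /sigma_finiteP[G [TG ndG Goo]] := sigma_finiteT mu.
exists (fun k => @rV_uncons n @^-1` (F k `*` G k)) => [|k].
  apply/esym; rewrite -subTset => x _.
  have [i _ Fi] : (\bigcup_k F k) (rV_uncons x).1 by rewrite -TF.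
  have [j _ Gj] : (\bigcup_k G k) (rV_uncons x).2 by rewrite -TG.
  exists (maxn i j) => //; split.
  - by move: Fi; exact/subsetPset/ndF/leq_maxl.
  - by move: Gj; exact/subsetPset/ndG/leq_maxr.
have [mF Fk] := Foo k; have [mG Gk] := Goo k; split.
  rewrite -[X in measurable X]setTI.
  by apply: measurable_rV_uncons => //; exact: measurableX.
by rewrite lebesgue_rVSE// lte_mul_pinfty// ge0_fin_numE.
Qed.

HB.instance Definition _ :=
  @Measure_isSigmaFinite.Build _ _ _ lebesgue_rVS sigma_finite_lebesgue_rVS.

End lebesgue_rVS.

(* Lebesgue measure on R^n, the n-fold product of one-dimensional Lebesgue
   measure; the one-point space R^0 has mass 1. *)
Fixpoint lebesgue_rV n : {sigma_finite_measure set 'rV[R]_n -> \bar R} :=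
  match n with
  | 0 => dirac (0 : 'rV[R]_0)
  | m.+1 => lebesgue_rVS (lebesgue_rV m)
  end.

End lebesgue_rV.

Section box.
Context {R : realType} {d : nat}.
Implicit Types a b : 'I_d -> R.

Definition box a b : set 'rV[R]_d := [set x | forall i, a i <= x ord0 i <= b i].

Lemma measurable_box a b : measurable (box a b).
Proof.
rewrite (_ : box a b = \bigcap_(i in [set: 'I_d])
    ((fun x : 'rV[R]_d => x ord0 i) @^-1` `[a i, b i]%classic)).
  apply: fin_bigcap_measurable => // i _; rewrite -[X in measurable X]setTI.
  exact: measurable_coord.
apply/seteqP; split => x /= H i; first by move=> _; rewrite /= in_itv; exact: H.
by have := H i Logic.I; rewrite /= in_itv.
Qed.

(* Lebesgue measure on the box; its L^p spaces are the L^p(S), values outside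
   the box being irrelevant. *)
Definition box_measure a b : {measure set 'rV[R]_d -> \bar R} :=
  mrestr (lebesgue_rV d) (measurable_box a b).

End box.

Lemma lebesgue_rV_box (R : realType) d (a b : 'I_d -> R) :
  (forall i, a i <= b i) ->
  lebesgue_rV d (box a b) = (\prod_i (b i - a i))%:E.
Proof.
elim: d a b => [|d IH] a b ab.
  by rewrite big_ord0 /= diracE mem_set// => -[].
rewrite big_ord_recl/= EFinM -IH//.
rewrite (_ : box a b = @rV_uncons R d @^-1` (`[a ord0, b ord0]%classic `*`
    box (fun i => a (lift ord0 i)) (fun i => b (lift ord0 i)))).
  rewrite [LHS]lebesgue_rVSE//; last exact: measurable_box.
  rewrite lebesgue_measure_itv/= lte_fin; congr (_ * _)%E.
  have := ab ord0; rewrite le_eqVlt => /predU1P[->|->]; last by rewrite EFinB.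
  by rewrite ltxx subrr.
apply/seteqP; split => x /= H.
  split; first by rewrite /= in_itv/=; exact: H.
  by move=> i; rewrite /= mxE.
case: H => /=; rewrite in_itv/= => H0 H i.
by case: (unliftP ord0 i) => [j ->|->//]; have := H j; rewrite mxE.
Qed.

(* Operators on L^p are given on representatives: they have to respect a.e.
   equality, and identities between them hold a.e. *)
Section Lp_operators.
Context d (T : measurableType d) (R : realType).
Variables (mu : {measure set T -> \bar R}) (p : \bar R).
Implicit Types (A : (T -> R) -> (T -> R)) (f g : T -> R).

Definition Lp_linear A :=
  [/\ forall f, f \in Lfun mu p -> A f \in Lfun mu p,
      forall f g, f \in Lfun mu p -> g \in Lfun mu p ->
        f = g %[ae mu] -> A f = A g %[ae mu]
    & forall k f g, f \in Lfun mu p -> g \in Lfun mu p ->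
        A (fun x => k * f x + g x) = (fun x => k * A f x + A g x) %[ae mu]].

Definition Lp_contraction A :=
  forall f, f \in Lfun mu p ->
    ('N[mu]_p[EFin \o A f] <= 'N[mu]_p[EFin \o f])%E.

Definition Lp_bounded A :=
  exists C : R, forall f, f \in Lfun mu p ->
    ('N[mu]_p[EFin \o A f] <= C%:E * 'N[mu]_p[EFin \o f])%E.

Definition Lp_idempotent A :=
  forall f, f \in Lfun mu p -> A (A f) = A f %[ae mu].

Definition Lp_projection A :=
  [/\ Lp_linear A, Lp_bounded A & Lp_idempotent A].

End Lp_operators.

Section coordinate_averages.
Context {R : realType} {d : nat}.
Variables a b : 'I_d -> R.
Implicit Types (f g psi : 'rV[R]_d -> R) (i : 'I_d) (I : {set 'I_d}).

Local Notation mu := (box_measure a b).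

(* (x_{-i}, t): t is inserted as the i-th coordinate *)
Definition set_coord (x : 'rV[R]_d) i (t : R) : 'rV[R]_d :=
  \row_j (if j == i then t else x ord0 j).

(* The coordinate-i average, for representatives of L^1(S) functions. At the
   points (a null set) whose fibre in direction i is not integrable, [Rintegral]
   takes a junk finite value. *)
Definition avg i f : 'rV[R]_d -> R := fun x =>
  (b i - a i)^-1 * \int[lebesgue_measure]_(t in `[a i, b i]) f (set_coord x i t).

(* prod_(i in I) (Id - Pi_i): a composition, in the increasing order of the
   indices (the factors commute only up to a.e. equality). *)
Definition calP I : ('rV[R]_d -> R) -> ('rV[R]_d -> R) :=
  \big[(fun A B => A \o B)/id]_(i in I) (fun f x => f x - avg i f x).

Definition calR I : ('rV[R]_d -> R) -> ('rV[R]_d -> R) :=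
  fun f x => f x - calP I f x.

Definition centered_dir i f :=
  f \in Lfun mu 1%E /\ avg i f = cst 0 %[ae mu].

Definition centered I f := forall i, i \in I -> centered_dir i f.

Definition partial i f : 'rV[R]_d -> R := fun x => 'D_(delta_mx ord0 i) f x.

(* C^infinity: the iterated partial derivatives of all orders exist and are
   continuous. *)
Definition smooth f :=
  forall s : seq 'I_d, continuous (foldr partial f s) /\
    forall i x, derivable (foldr partial f s) x (delta_mx ord0 i).

(* Smooth functions with compact support in the interior of S. *)
Definition test_function psi :=
  [/\ smooth psi, compact (closure [set x | psi x != 0])
    & closure [set x | psi x != 0] `<=` interior (box a b)].

Definition weak_partial i f g := forall psi, test_function psi ->
  \int[mu]_x (f x * partial i psi x) = - \int[mu]_x (g x * psi x).

(* The Sobolev space W^{1,oo}(S), through weak derivatives. *)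
Definition W1oo f := f \in Lfun mu +oo%E /\
  forall i, exists2 g, g \in Lfun mu +oo%E & weak_partial i f g.

End coordinate_averages.

(* Main.v *)
Require Import Defs.
From HB Require Import structures.
From mathcomp Require Import all_boot all_order all_algebra.
From mathcomp Require Import all_classical all_reals all_analysis.
From mathcomp Require Import measurable_realfun ess_sup_inf.
From mathcomp Require Import ring.

Set Implicit Arguments.
Unset Strict Implicit.
Unset Printing Implicit Defensive.
Import Order.TTheory GRing.Theory Num.Theory.
Import numFieldNormedType.Exports.

Local Open Scope classical_set_scope.
Local Open Scope ring_scope.

(** The average Pi_i replaces the i-th coordinate of a point by an independent
uniform one. It is therefore an instance of an operator
  (average f) x = E [f (Phi (x, t))],  t distributed according to P,
where Phi : T * U -> T transports mu \x P to mu. Everything about L^p follows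
from this invariance: Tonelli's theorem gives that averaging preserves
integrals, so that it respects almost everywhere equality and integrability on
almost every fibre; with Jensen's inequality it gives the L^p contraction
([Lnorm_average]). Overwriting a coordinate twice amounts to overwriting it
once, hence idempotence ([averageK]) and self-adjointness
([average_self_adjoint]); overwriting two different coordinates can be done in
any order, hence commutation by Fubini's theorem ([ae_average_commute]). The
invariance for the box ([insert_coord_invariant]) is checked on rectangles.

The statements on P_I and R_I are then algebra of commuting projections: a
factor Id - Pi_i of P_I can be moved to the front and absorbed, so that
(Id - Pi_i) P_I = P_I, that is Pi_i P_I = 0, for i in I
([residual_residuals]); conversely P_I fixes every function which is centered
on I ([residuals_fixed]).

For W^(1,oo), the weak partial derivative of Pi_i f in direction j is
Pi_i (D_j f) if j <> i, and 0 if j = i. By self-adjointness the average can be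
moved to the test function psi. If j = i, then Pi_i (D_i psi) = 0 by the
fundamental theorem of calculus, psi being 0 at both ends of each fibre. If
j <> i, then Pi_i psi is constant in the coordinate i and is not a test
function. However, for fixed s, the function psi(x_{-i}, s) chi(x_i) is one
when chi is a smooth cutoff supported in the open interval ]a_i, b_i[, and its
j-th derivative does not see chi. The weak derivative of f may be tested
against it; letting chi tend to 1 ([weak_partial_fibre]) and averaging over s
gives the claim without differentiating under the integral sign. The cutoffs
are built from exp(-1/x). *)

(** * Averaging along a measure-preserving substitution *)

Section average.
Context d d' (T : measurableType d) (U : measurableType d') (R : realType).
Variables (mu : {finite_measure set T -> \bar R}) (P : probability U R).
Variable Phi : T * U -> T.

(** For the coordinate averages, [Phi (x, t)] will be x with t inserted as one of
its coordinates. *)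
Definition average (f : T -> R) (x : T) : R := \int[P]_t f (Phi (x, t)).

Hypothesis mPhi : measurable_fun setT Phi.
Hypothesis PhiE : forall A, measurable A -> (mu \x P)%E (Phi @^-1` A) = mu A.

(* [probability_setT] in the form in which rewriting finds the measure. *)
Let P1 : (P : {measure set U -> \bar R}) setT = 1%E.
Proof. exact: probability_setT. Qed.

Lemma measurable_section dV (W : measurableType dV) (f : T -> W) x :
  measurable_fun setT f -> measurable_fun setT (fun t => f (Phi (x, t))).
Proof.
move=> mf; apply: (measurableT_comp mf).
by apply: (measurableT_comp mPhi); exact: measurable_pair1.
Qed.

Lemma average_tonelli (f : T -> \bar R) : measurable_fun setT f ->
  (forall x, 0 <= f x)%E ->
  (\int[mu]_x \int[P]_t f (Phi (x, t)) = \int[mu]_x f x)%E.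
Proof.
move=> mf f0.
rewrite -(@fubini_tonelli1 _ _ _ _ _ mu P (f \o Phi)); first last.
- by move=> z; exact: f0.
- exact: measurableT_comp.
rewrite -[setT]/(Phi @^-1` setT) -ge0_integral_pushforward//.
by apply: eq_measure_integral => A mA _; exact: PhiE.
Qed.

Lemma measurable_average_ge0 (f : T -> \bar R) : measurable_fun setT f ->
  (forall x, 0 <= f x)%E ->
  measurable_fun setT (fun x => \int[P]_t f (Phi (x, t)))%E.
Proof.
move=> mf f0.
apply: (@measurable_fun_fubini_tonelli_F _ _ _ _ _ P (f \o Phi)).
  exact: measurableT_comp.
by move=> z; exact: f0.
Qed.

Lemma measurable_average (f : T -> R) : measurable_fun setT f ->
  measurable_fun setT (average f).
Proof.
move=> mf; rewrite (_ : average f = fun x => fine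
   (\int[P]_t (EFin \o f)^\+ (Phi (x, t)) - \int[P]_t (EFin \o f)^\- (Phi (x, t)))%E).
  have mf' : measurable_fun setT (EFin \o f) by exact/measurable_EFinP.
  apply: (measurableT_comp (fine_measurable measurableT)).
  apply: emeasurable_funB; apply: measurable_average_ge0 => //.
    exact: measurable_funepos.
  exact: measurable_funeneg.
apply/funext => x; rewrite /average /Rintegral integralE.
by congr (fine (_ - _)%E); apply: eq_integral => t _;
  rewrite ?funeposE ?funenegE.
Qed.

(** The exceptional set has measure 0, and this measure is the integral of the
measures of its sections. *)
Lemma ae_section (Q : T -> Prop) : {ae mu, forall x, Q x} ->
  {ae mu, forall x, {ae P, forall t, Q (Phi (x, t))}}.
Proof.
move=> [N [mN N0 QN]].
have m1 : measurable_fun setT (fun x => (\1_N x)%:E : \bar R).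
  by apply/measurable_EFinP; exact: measurable_indic.
have i0 x : (0 <= (\1_N x)%:E :> \bar R)%E by rewrite lee_fin.
have /ae_eq_integral_abs : (measurable_fun setT
    (fun x => \int[P]_t (\1_N (Phi (x, t)))%:E)%E).
  exact: (measurable_average_ge0 m1).
move=> /(_ mu measurableT)[+ _].
under eq_integral => x _ do rewrite gee0_abs ?integral_ge0//.
rewrite (average_tonelli m1)// integral_indic// setIT => /(_ N0).
apply: filterS => x /(_ Logic.I) /= Nx.
exists ((fun t => Phi (x, t)) @^-1` N); split.
- rewrite -[X in measurable X]setTI.
  by apply: (measurable_section (f := id)).
- rewrite -Nx [RHS](_ : _ = \int[P]_t (\1_((fun t => Phi (x, t)) @^-1` N) t)%:E)%E//.
  rewrite integral_indic ?setIT//.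
  rewrite -[X in measurable X]setTI.
  by apply: (measurable_section (f := id)).
- by move=> t /= /QN.
Qed.

Lemma ae_eq_average (f g : T -> R) : measurable_fun setT f ->
  measurable_fun setT g -> f = g %[ae mu] -> average f = average g %[ae mu].
Proof.
move=> mf mg /ae_section; apply: filterS => x fg _.
congr fine; apply: ae_eq_integral => //.
- by apply/measurable_EFinP; exact: measurable_section.
- by apply/measurable_EFinP; exact: measurable_section.
- by apply: filterS fg => t /(_ Logic.I) + _ => /= ->.
Qed.

Lemma integrable_comp_Phi (f : T -> \bar R) : mu.-integrable setT f ->
  (mu \x P)%E.-integrable setT (f \o Phi).
Proof.
move=> /integrableP[mf fy]; have mfPhi := measurableT_comp mf mPhi.
apply/(integrable12ltyP mu P) => //=.
have maf : measurable_fun setT (abse \o f) by exact: measurableT_comp.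
by rewrite (average_tonelli maf) => // x; exact: abse_ge0.
Qed.

Lemma ae_integrable_section (f : T -> R) : mu.-integrable setT (EFin \o f) ->
  {ae mu, forall x, P.-integrable setT (fun t => (f (Phi (x, t)))%:E)}.
Proof. by move=> /integrable_comp_Phi/ae_integrable1. Qed.

Lemma Rintegral_average (f : T -> R) : mu.-integrable setT (EFin \o f) ->
  \int[mu]_x average f x = \int[mu]_x f x.
Proof.
move=> intf; have intfPhi := integrable_comp_Phi intf.
have [mf _] := integrableP _ _ _ intf.
congr fine; transitivity (\int[mu]_x \int[P]_t (f (Phi (x, t)))%:E)%E.
  apply: ae_eq_integral => //.
  - by apply/measurable_EFinP/measurable_average/measurable_EFinP.
  - exact: (measurable_fubini_F intfPhi).
  - apply: filterS (ae_integrable_section intf) => x fx _ /=.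
    by rewrite /average /Rintegral fineK//; exact: integrable_fin_num.
rewrite (integral12_prod_meas1 intfPhi).
rewrite -[setT]/(Phi @^-1` setT) -(integral_pushforward mPhi)//.
by apply: eq_measure_integral => A mA _; exact: PhiE.
Qed.

Lemma ae_average_linear k (f g : T -> R) : mu.-integrable setT (EFin \o f) ->
  mu.-integrable setT (EFin \o g) ->
  average (fun x => k * f x + g x) = (fun x => k * average f x + average g x)
    %[ae mu].
Proof.
move=> intf intg.
move: (ae_integrable_section intf) (ae_integrable_section intg).
apply: filterS2 => x fx gx _; rewrite /average RintegralD//.
  by rewrite RintegralZl.
exact: (integrableZl measurableT k fx).
Qed.

(** This includes the fibres on which f is not integrable: there the average is
0. *)
Lemma normr_average_le (f : T -> R) x : measurable_fun setT f ->
  (`|average f x|%:E <= \int[P]_t `|(f (Phi (x, t)))%:E|)%E.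
Proof.
move=> mf; apply: le_trans (le_abse_integral _ _ _) => //; last first.
  by apply/measurable_EFinP; exact: measurable_section.
by rewrite /average /Rintegral; case: (integral _ _ _) => [r||] /=;
  rewrite ?normr0 ?leey.
Qed.

(** Jensen's inequality for the power function, obtained from Hoelder's
inequality against the constant 1, whose norms are 1 for a probability. *)
Lemma powR_average_le (p : R) (f : T -> R) x : 1 <= p ->
  measurable_fun setT f ->
  ((`|average f x| `^ p)%:E <= \int[P]_t (`|f (Phi (x, t))| `^ p)%:E)%E.
Proof.
move=> p1 mf; have p0 : 0 < p by exact: lt_le_trans p1.
set h := fun t => f (Phi (x, t)).
have mh : measurable_fun setT h by exact: measurable_section.
rewrite -poweR_EFin.
have -> : (\int[P]_t (`|f (Phi (x, t))| `^ p)%:E = 'N[P]_p%:E[EFin \o h] `^ p)%E.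
  by rewrite poweR_Lnorm ?gt_eqF//.
apply: gt0_ler_poweR; first exact: ltW.
- by rewrite in_itv/= leey lee_fin normr_ge0.
- by rewrite in_itv/= leey Lnorm_ge0.
apply: (le_trans (normr_average_le x mf)); rewrite -/h -Lnorm1.
move: p1; rewrite le_eqVlt => /predU1P[<-//|p1].
have := @hoelder _ _ _ P h (cst 1) p (1 - p^-1)^-1 mh.
have -> : ('N[P]_((1 - p^-1)^-1)%:E[EFin \o cst 1%R] = 1)%E.
  by rewrite [LHS]Lnorm_cst1 P1 poweR1r.
rewrite mule1.
have -> : (h \* cst 1)%R = h by apply/funext => t /=; rewrite mulr1.
apply => //; first by rewrite invr_gt0 subr_gt0 invf_lt1.
by rewrite invrK subrKC.
Qed.

(** For finite p, integrate Jensen's inequality over x and use that averaging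
preserves integrals. For p infinite, almost every fibre is bounded by the
essential supremum almost everywhere. *)
Lemma Lnorm_average (p : \bar R) (f : T -> R) : (1 <= p)%E ->
  measurable_fun setT f ->
  ('N[mu]_p[EFin \o average f] <= 'N[mu]_p[EFin \o f])%E.
Proof.
move=> + mf; have maf := measurable_average mf.
case: p => [p|_|//].
  rewrite lee_fin => p1; have p0 : 0 < p by exact: lt_le_trans p1.
  rewrite unlock /Lnorm; apply: gt0_ler_poweR.
  - by rewrite invr_ge0 ltW.
  - by rewrite in_itv/= leey integral_ge0// => y _; rewrite poweR_ge0.
  - by rewrite in_itv/= leey integral_ge0// => y _; rewrite poweR_ge0.
  have mpow (g : T -> R) : measurable_fun setT g ->
      measurable_fun setT (fun x => (`|g x| `^ p)%:E).
    move=> mg; apply/measurable_EFinP/(@measurableT_comp _ _ _ _ _ _ (@powR R ^~ p)) => //.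
    exact: measurableT_comp.
  rewrite -(average_tonelli (mpow _ mf)); last by move=> x; rewrite lee_fin powR_ge0.
  apply: ge0_le_integral => //.
  - by move=> x _; rewrite poweR_ge0.
  - exact: mpow.
  - by apply: (measurable_average_ge0 (mpow _ mf)) => x; rewrite lee_fin powR_ge0.
  - by move=> x _; exact: powR_average_le.
rewrite unlock /Lnorm; case: ifPn => // mu0; apply/ess_supP.
apply: filterS (ae_section (ess_sup_ge mu (abse \o (EFin \o f)))) => x fx.
apply: le_trans (normr_average_le x mf) _.
set M := ess_sup _ _.
apply: (@le_trans _ _ (\int[P]_t M)%E); last first.
  by rewrite integral_cst// [X in (_ * X)%E](probability_setT P) mule1.
apply: ae_ge0_le_integral => //.
- by apply: measurableT_comp => //; apply/measurable_EFinP; exact: measurable_section.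
- by move=> t _; apply: ess_sup_gee => //; apply: nearW => y; exact: abse_ge0.
- by apply: filterS fx => t.
Qed.

Lemma Lfun_average (p : \bar R) (f : T -> R) : (1 <= p)%E ->
  f \in Lfun mu p -> average f \in Lfun mu p.
Proof.
move=> p1 /andP[/[!inE]/= mf fp]; apply/andP; split; rewrite inE/=.
  exact: measurable_average.
exact: le_lt_trans (Lnorm_average p1 mf) fp.
Qed.

(** ** Substitutions that overwrite *)

Section overwriting.
Hypothesis PhiK : forall x s t, Phi (Phi (x, s), t) = Phi (x, t).

Lemma average_Phi (f : T -> R) x s : average f (Phi (x, s)) = average f x.
Proof. by rewrite /average; under eq_Rintegral do rewrite PhiK. Qed.

Lemma averageK (f : T -> R) : average (average f) = average f.
Proof.
apply/funext => x; rewrite {1}/average.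
under eq_Rintegral do rewrite average_Phi.
by rewrite Rintegral_cst// P1 mulr1.
Qed.

Lemma average_pull (f h : T -> R) x :
  P.-integrable setT (fun t => (h (Phi (x, t)))%:E) ->
  average (fun y => average f y * h y) x = average f x * average h x.
Proof.
move=> inth; rewrite {1}/average.
by under eq_Rintegral do rewrite average_Phi; rewrite RintegralZl.
Qed.

(** Both sides are the integral of the product of the two averages. *)
Lemma average_self_adjoint (f h : T -> R) :
  mu.-integrable setT (EFin \o f) -> mu.-integrable setT (EFin \o h) ->
  mu.-integrable setT (fun x => (average f x * h x)%:E) ->
  mu.-integrable setT (fun x => (average h x * f x)%:E) ->
  \int[mu]_x (average f x * h x) = \int[mu]_x (f x * average h x).
Proof.
move=> intf inth intfh inthf.
under [RHS]eq_Rintegral do rewrite mulrC.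
have mE (g : T -> R) : mu.-integrable setT (EFin \o g) -> measurable_fun setT g.
  by move=> /integrableP[/measurable_EFinP].
rewrite -(Rintegral_average intfh) -(Rintegral_average inthf).
congr fine; apply: ae_eq_integral => //.
- by apply/measurable_EFinP/measurable_average/mE.
- by apply/measurable_EFinP/measurable_average/mE.
move: (ae_integrable_section intf) (ae_integrable_section inth).
apply: filterS2 => x fx hx _; congr EFin.
by rewrite !average_pull// mulrC.
Qed.

End overwriting.

End average.

(** ** Two commuting substitutions *)

Section Rintegral_Fubini.
Context d1 d2 (T1 : measurableType d1) (T2 : measurableType d2) (R : realType).
Variables (m1 : {sigma_finite_measure set T1 -> \bar R}).
Variables (m2 : {sigma_finite_measure set T2 -> \bar R}).

Lemma Rintegral_Fubini (f : T1 * T2 -> R) :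
  (m1 \x m2)%E.-integrable setT (EFin \o f) ->
  \int[m1]_x \int[m2]_y f (x, y) = \int[m2]_y \int[m1]_x f (x, y).
Proof.
move=> intf; have := Fubini intf; rewrite /Rintegral => fub; congr fine.
transitivity (\int[m1]_x \int[m2]_y (f (x, y))%:E)%E.
  apply: ae_eq_integral => //.
  - apply/measurable_EFinP; apply: (measurableT_comp (fine_measurable measurableT)).
    exact: (measurable_fubini_F intf).
  - exact: (measurable_fubini_F intf).
  apply: filterS (ae_integrable1 intf) => x fx _ /=.
  by rewrite fineK//; exact: integrable_fin_num.
rewrite [LHS]fub; apply/esym; apply: ae_eq_integral => //.
- apply/measurable_EFinP; apply: (measurableT_comp (fine_measurable measurableT)).
  exact: (measurable_fubini_G intf).
- exact: (measurable_fubini_G intf).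
apply: filterS (ae_integrable2 intf) => x fx _ /=.
by rewrite fineK//; exact: integrable_fin_num.
Qed.

End Rintegral_Fubini.

Section average_commute.
Context d d1 d2 (T : measurableType d) (U1 : measurableType d1)
  (U2 : measurableType d2) (R : realType).
Variables (mu : {finite_measure set T -> \bar R}).
Variables (P1 : probability U1 R) (P2 : probability U2 R).
Variables (Phi1 : T * U1 -> T) (Phi2 : T * U2 -> T).
Hypothesis mPhi1 : measurable_fun setT Phi1.
Hypothesis mPhi2 : measurable_fun setT Phi2.
Hypothesis Phi1E : forall A, measurable A -> (mu \x P1)%E (Phi1 @^-1` A) = mu A.
Hypothesis Phi2E : forall A, measurable A -> (mu \x P2)%E (Phi2 @^-1` A) = mu A.
Hypothesis PhiC : forall x s t, Phi1 (Phi2 (x, t), s) = Phi2 (Phi1 (x, s), t).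

(** Almost every x carries a function of (s, t) which is integrable for the
product of the two probabilities, so that Fubini's theorem applies to it. *)
Lemma ae_average_commute (f : T -> R) : mu.-integrable setT (EFin \o f) ->
  average P1 Phi1 (average P2 Phi2 f) = average P2 Phi2 (average P1 Phi1 f)
    %[ae mu].
Proof.
move=> /integrableP[mf fy].
have maf : measurable_fun setT (abse \o (EFin \o f)) by exact: measurableT_comp.
have af0 x : (0 <= (abse \o (EFin \o f)) x)%E by exact: abse_ge0.
pose g x := (\int[P2]_t `|(f (Phi2 (x, t)))%:E|)%E.
have mg : measurable_fun setT g by exact: (measurable_average_ge0 P2 mPhi2 maf af0).
have g0 x : (0 <= g x)%E by exact: integral_ge0.
pose h x := (\int[P1]_s g (Phi1 (x, s)))%E.
have : mu.-integrable setT h.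
  apply/integrableP; split; first exact: (measurable_average_ge0 P1 mPhi1 mg).
  under eq_integral do rewrite gee0_abs ?integral_ge0//.
  by rewrite (average_tonelli mPhi1 Phi1E mg)// (average_tonelli mPhi2 Phi2E maf af0).
move=> /(integrable_ae measurableT); apply: filterS => x /(_ Logic.I) hx _.
rewrite /average.
have intx : (P1 \x P2)%E.-integrable setT
    (EFin \o (fun st => f (Phi2 (Phi1 (x, st.1), st.2)))).
  apply/integrable12ltyP; last first.
    by move: hx; rewrite ge0_fin_numE //; apply: integral_ge0 => s _; exact: g0.
  apply: (measurableT_comp mf); apply: (measurableT_comp mPhi2).
  apply/measurable_fun_pairP; split; last exact: measurable_snd.
  apply: (measurableT_comp mPhi1); apply/measurable_fun_pairP; split.
    exact: measurable_cst.
  exact: measurable_fst.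
rewrite (Rintegral_Fubini intx) /=.
by apply: eq_Rintegral => t _; apply: eq_Rintegral => s _; rewrite PhiC.
Qed.

End average_commute.

(** * The box and the substitution of one coordinate *)

Section rectangles.
Context {R : realType}.

Definition rectangle d (A : 'I_d -> set R) : set 'rV[R]_d :=
  [set x | forall i, A i (x ord0 i)].

Lemma measurable_rectangle d (A : 'I_d -> set R) :
  (forall i, measurable (A i)) -> measurable (rectangle A).
Proof.
move=> mA; rewrite (_ : rectangle A = \bigcap_(i in [set: 'I_d])
    ((fun x : 'rV[R]_d => x ord0 i) @^-1` A i)).
  apply: fin_bigcap_measurable => // i _; rewrite -[X in measurable X]setTI.
  exact: measurable_coord.
by apply/seteqP; split => x /= H i; [move=> _; exact: H|exact: H].
Qed.

Lemma lebesgue_rV_rectangle d (A : 'I_d -> set R) :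
  (forall i, measurable (A i)) ->
  lebesgue_rV d (rectangle A) = (\prod_(i < d) lebesgue_measure (A i))%E.
Proof.
elim: d A => [|d IH] A mA.
  by rewrite big_ord0 /= diracE mem_set// => -[].
rewrite big_ord_recl -IH//.
rewrite (_ : rectangle A = @rV_uncons R d @^-1` (A ord0 `*`
    rectangle (fun i => A (lift ord0 i)))).
  by rewrite [LHS]lebesgue_rVSE//; exact: measurable_rectangle.
apply/seteqP; split => x /= H.
  by split; [exact: H|move=> i; rewrite /= mxE; exact: H].
case: H => /= H0 H i.
by case: (unliftP ord0 i) => [j ->|->//]; have := H j; rewrite mxE.
Qed.

(** Rectangles form a pi-system which contains the whole space and generates
the product sigma-algebra. *)
Lemma finite_measure_rV_unique d (m1 m2 : {measure set 'rV[R]_d -> \bar R}) :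
  (m1 setT < +oo)%E ->
  (forall A, (forall i, measurable (A i)) ->
    m1 (rectangle A) = m2 (rectangle A)) ->
  forall B, measurable B -> m1 B = m2 B.
Proof.
move=> m1oo m12 B mB.
pose G := [set B | exists2 A : 'I_d -> set R, forall i, measurable (A i) &
  B = rectangle A].
have GT : G setT by exists (fun=> setT) => //; apply/seteqP; split.
apply: (measure_unique G (fun=> setT)) => //.
- apply/seteqP; split; last first.
    apply: smallest_sub; first exact: sigma_algebra_measurable.
    by move=> _ [A mA ->]; exact: measurable_rectangle.
  apply: smallest_sub; first exact: smallest_sigma_algebra.
  move=> C; rewrite -bigcup_seq/= => -[i _ [D mD <-]].
  apply: sub_sigma_algebra; exists (fun j => if j == i then D else setT).
    by move=> j; case: ifP.
  rewrite setTI; apply/seteqP; split => x /=.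
    by move=> Dx j; case: ifPn => // /eqP ->.
  by move=> /(_ i); rewrite eqxx.
- move=> _ _ [A mA ->] [A' mA' ->]; exists (fun i => A i `&` A' i).
    by move=> i; exact: measurableI.
  by apply/seteqP; split => x /= => [[? ?] i|H]; split => // i; case: (H i).
- by apply/seteqP; split => // x _; exists 0%N.
- by move=> _ [A mA ->]; exact: m12.
Qed.

End rectangles.

Section box_average.
Context {R : realType} {d : nat}.
Variables a b : 'I_d -> R.

Let box_fin : (forall i, a i < b i) -> (lebesgue_rV d (box a b) < +oo)%E.
Proof. by move=> hab; rewrite lebesgue_rV_box ?ltry// => i; exact: ltW. Qed.

Hypothesis hab : forall i, a i < b i.

(** The measure [box_measure a b], with its finiteness registered. *)
Definition fin_box_measure : {finite_measure set 'rV[R]_d -> \bar R} :=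
  mfrestr (measurable_box a b) (box_fin hab).

Definition fibre_prob i : probability (measurableTypeR R) R := uniform_prob (hab i).

Definition insert_coord i (p : 'rV[R]_d * R) := set_coord p.1 i p.2.

Lemma measurable_insert_coord i : measurable_fun setT (insert_coord i).
Proof.
apply: measurable_fun_coordP => j.
rewrite [X in measurable_fun _ X](_ : _ =
    if j == i then snd else (fun x : 'rV[R]_d => x ord0 j) \o fst); last first.
  by apply/funext => p /=; rewrite mxE; case: ifP.
case: ifP => _; first exact: measurable_snd.
apply: measurableT_comp; first exact: measurable_coord.
exact: measurable_fst.
Qed.

Lemma insert_coordK i x s t :
  insert_coord i (insert_coord i (x, s), t) = insert_coord i (x, t).
Proof. by apply/rowP => j; rewrite /insert_coord/= !mxE; case: eqP. Qed.

Lemma insert_coordC i j x s t : i != j ->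
  insert_coord i (insert_coord j (x, t), s) =
  insert_coord j (insert_coord i (x, s), t).
Proof.
move=> ij; apply/rowP => k; rewrite /insert_coord/= !mxE /=.
by have [->|//] := eqVneq k i; rewrite (negbTE ij).
Qed.

Lemma fibre_probE i A : measurable A -> fibre_prob i A =
  ((b i - a i)^-1%:E * lebesgue_measure (A `&` `[a i, b i]%classic))%E.
Proof.
move=> mA; have m1A : measurable_fun setT (fun x => (\1_A x)%:E : \bar R).
  by apply/measurable_EFinP; exact: measurable_indic.
have i0 x : (0 <= (\1_A x)%:E :> \bar R)%E by rewrite lee_fin.
rewrite -[A in LHS]setIT -integral_indic//.
by rewrite [LHS](integral_uniform (hab i) m1A i0) integral_indic.
Qed.

(** Overwriting the i-th coordinate by an independent uniform one preserves the
uniform law of a point of the box. On a rectangle, the i-th factor of the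
measure is lost and is restored by the law of the new coordinate. *)
Lemma insert_coord_invariant i A : measurable A ->
  (fin_box_measure \x fibre_prob i)%E (insert_coord i @^-1` A) =
  fin_box_measure A.
Proof.
pose nu : {measure set 'rV[R]_d -> \bar R} :=
  measure_function_pushforward__canonical__measure_function_Measure
    (fin_box_measure \x fibre_prob i)%E (measurable_insert_coord i).
move=> mA; apply/esym.
apply: (@finite_measure_rV_unique R d fin_box_measure nu) mA => //.
  by rewrite ltey_eq fin_num_measure.
move=> {}A mA.
have preE : insert_coord i @^-1` rectangle A =
    rectangle (fun j => if j == i then setT else A j) `*` A i.
  apply/seteqP; split; move=> [x t] /=.
    rewrite /insert_coord/= => H; split => [j|].
      by have := H j; rewrite !mxE; case: ifP.
    by have := H i; rewrite mxE eqxx.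
  move=> [H Ai] j; have := H j; rewrite /insert_coord !mxE/=.
  by case: eqP => [->|].
have mA' j : measurable (if j == i then setT else A j) by case: ifP.
transitivity ((fin_box_measure \x fibre_prob i)%E
  (insert_coord i @^-1` rectangle A)); last by [].
rewrite preE [RHS](product_measure1E fin_box_measure (fibre_prob i)
  (measurable_rectangle mA') (mA i)).
have boxE (B : 'I_d -> set R) : (forall j, measurable (B j)) ->
    fin_box_measure (rectangle B) =
    (\prod_(j < d) lebesgue_measure (B j `&` `[a j, b j]%classic))%E.
  move=> mB; rewrite -lebesgue_rV_rectangle; last by move=> j; exact: measurableI.
  rewrite /fin_box_measure/= /mfrestr/= /mrestr; congr (_ _).
  apply/seteqP; split => x /=.
    by move=> [H1 H2] j; split; [exact: H1|rewrite /= in_itv/=; exact: H2].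
  by move=> H; split => j; have [? +] := H j; rewrite //= in_itv.
rewrite [LHS](boxE _ mA) [X in _ = (X * _)%E](boxE _ mA').
rewrite [X in _ = (_ * X)%E](fibre_probE i (mA i)).
rewrite (bigD1 i)//= [in RHS](bigD1 i)//= eqxx setTI.
rewrite lebesgue_measure_itv/= lte_fin hab.
under [in RHS]eq_bigr => j ji do rewrite (negbTE ji).
rewrite -EFinD muleACA -EFinM mulfV; last by rewrite subr_eq0 gt_eqF.
by rewrite mul1e muleC.
Qed.

(** This also holds on the fibres where f is not integrable: the integrals of
the positive and negative parts are multiplied by the same positive constant,
and both sides take the value 0 if one of them is infinite. *)
Lemma avgE i (f : 'rV[R]_d -> R) : measurable_fun setT f ->
  avg a b i f = average (fibre_prob i) (insert_coord i) f.
Proof.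
move=> mf; apply/funext => x; rewrite /avg /average /Rintegral.
set h := fun t => (f (set_coord x i t))%:E.
have mh : measurable_fun setT h.
  apply/measurable_EFinP.
  exact: (measurable_section (measurable_insert_coord i) x mf).
rewrite [in RHS]integralE (@integral_uniform _ _ _ (hab i) (h^\+)%E)//; last first.
  exact: measurable_funepos.
rewrite (@integral_uniform _ _ _ (hab i) (h^\-)%E)//; last first.
  exact: measurable_funeneg.
rewrite [X in _ * fine X = _](_ : _ = \int[lebesgue_measure]_(t in `[a i, b i]) h t)%E//.
rewrite [in LHS]integralE.
have c0 : 0 < (b i - a i)^-1 by rewrite invr_gt0 subr_gt0.
move: (@integral_ge0 _ _ _ lebesgue_measure `[a i, b i]%classic _ (fun t _ => funepos_ge0 h t)).
move: (@integral_ge0 _ _ _ lebesgue_measure `[a i, b i]%classic _ (fun t _ => funeneg_ge0 h t)).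
move: (integral _ _ _) (integral _ _ _) => [u| |] [v| |]//= _ _.
- by rewrite -mulrBr.
- by rewrite gt0_muley ?lte_fin//= mulr0.
- by rewrite gt0_muley ?lte_fin//= mulr0.
- by rewrite gt0_muley ?lte_fin//= mulr0.
Qed.

End box_average.

(** * Operators on L^p given on representatives *)

Section Lp_operator_algebra.
Context d (T : measurableType d) (R : realType).
Variables (mu : {measure set T -> \bar R}) (p : \bar R).
Hypothesis p1 : (1 <= p)%E.
Implicit Types (A B : (T -> R) -> (T -> R)) (f g : T -> R).

Lemma Lfun_measurable f : f \in Lfun mu p -> measurable_fun setT f.
Proof. by move=> /andP[/[!inE]]. Qed.

Lemma LfunB f g : f \in Lfun mu p -> g \in Lfun mu p ->
  (fun x => f x - g x) \in Lfun mu p.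
Proof. exact: (@rpredB _ (Lfun mu p)). Qed.

Lemma Lfun_lin k f g : f \in Lfun mu p -> g \in Lfun mu p ->
  (fun x => k * f x + g x) \in Lfun mu p.
Proof. by move=> fp gp; apply: (Lfun_submod_closed mu p1).2. Qed.

Lemma Lp_linear_id : Lp_linear mu p id.
Proof. by split => // k f g _ _; apply: aeW => x. Qed.

Lemma Lp_linear_comp A B : Lp_linear mu p A -> Lp_linear mu p B ->
  Lp_linear mu p (A \o B).
Proof.
move=> [Ap Aae Alin] [Bp Bae Blin]; split => [f fp|f g fp gp fg|k f g fp gp] /=.
- exact/Ap/Bp.
- by apply: Aae; [exact: Bp|exact: Bp|exact: Bae].
- apply: ae_eq_trans (Alin k _ _ (Bp _ fp) (Bp _ gp)).
  by apply: Aae; [exact/Bp/Lfun_lin|apply: Lfun_lin; exact: Bp|exact: Blin].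
Qed.

Lemma Lp_linear_sub A B : Lp_linear mu p A -> Lp_linear mu p B ->
  Lp_linear mu p (fun f x => A f x - B f x).
Proof.
move=> [Ap Aae Alin] [Bp Bae Blin]; split => [f fp|f g fp gp fg|k f g fp gp].
- by apply: LfunB; [exact: Ap|exact: Bp].
- apply: ae_eq_sub; [exact: Aae|exact: Bae].
- move: (Alin k f g fp gp) (Blin k f g fp gp).
  apply: filterS2 => x /(_ Logic.I) -> /(_ Logic.I) -> _.
  by rewrite mulrBr addrACA opprD.
Qed.

Lemma Lp_linearB A f g : Lp_linear mu p A -> f \in Lfun mu p ->
  g \in Lfun mu p ->
  A (fun x => f x - g x) = (fun x => A f x - A g x) %[ae mu].
Proof.
move=> [Ap Aae Alin] fp gp.
have := Alin (-1) g f gp fp; rewrite (_ : (fun x => -1 * g x + f x) = (fun x => f x - g x)).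
  by apply: filterS => x /(_ Logic.I) -> _; rewrite mulN1r addrC.
by apply/funext => x; rewrite mulN1r addrC.
Qed.

(** The constant in [Lp_bounded] may be negative when all the norms vanish. *)
Lemma Lp_bounded_ge0 A : Lp_bounded mu p A ->
  exists2 C : R, 0 <= C & forall f, f \in Lfun mu p ->
    ('N[mu]_p[EFin \o A f] <= C%:E * 'N[mu]_p[EFin \o f])%E.
Proof.
move=> [C AC]; exists `|C| => // f /AC /le_trans; apply.
by apply: lee_wpmul2r => //; rewrite ?Lnorm_ge0// lee_fin ler_norm.
Qed.

Lemma Lp_bounded_id : Lp_bounded mu p id.
Proof. by exists 1 => f _; rewrite mul1e. Qed.

Lemma Lp_bounded_comp A B : Lp_linear mu p B -> Lp_bounded mu p A ->
  Lp_bounded mu p B -> Lp_bounded mu p (A \o B).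
Proof.
move=> [Bp _ _] /Lp_bounded_ge0[C C0 AC] [D BD]; exists (C * D) => f fp /=.
apply: le_trans (AC _ (Bp _ fp)) _.
by rewrite EFinM -muleA lee_wpmul2l ?lee_fin ?BD.
Qed.

Lemma Lp_bounded_sub A B : Lp_linear mu p A -> Lp_linear mu p B ->
  Lp_bounded mu p A -> Lp_bounded mu p B ->
  Lp_bounded mu p (fun f x => A f x - B f x).
Proof.
move=> [Ap _ _] [Bp _ _] [C AC] [D BD]; exists (C + D) => f fp.
have mA := Lfun_measurable (Ap _ fp); have mB := Lfun_measurable (Bp _ fp).
have -> : EFin \o (fun x => A f x - B f x) = (EFin \o (A f \+ \- B f)%R) by [].
apply: le_trans (eminkowski _ mA _ p1) _; first exact: measurableT_comp.
rewrite (_ : EFin \o (\- B f)%R = \- (EFin \o B f))%E// oppe_Lnorm.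
have /andP[_ /[!inE]/= fpy] := fp.
rewrite EFinD muleDl//; first by apply: leeD; [exact: AC|exact: BD].
by rewrite ge0_fin_numE// Lnorm_ge0.
Qed.

End Lp_operator_algebra.

(** * Products of complements of commuting projections *)

Section commuting_projections.
Context d (T : measurableType d) (R : realType).
Variables (mu : {measure set T -> \bar R}) (p : \bar R).
Hypothesis p1 : (1 <= p)%E.
Variables (I : eqType) (A : I -> (T -> R) -> (T -> R)).
Hypothesis Alin : forall i, Lp_linear mu p (A i).
Hypothesis Abnd : forall i, Lp_bounded mu p (A i).
Hypothesis AK : forall i, Lp_idempotent mu p (A i).
Hypothesis AC : forall i j f, f \in Lfun mu p ->
  A i (A j f) = A j (A i f) %[ae mu].
Implicit Types (i j : I) (r : seq I) (f g : T -> R).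

Definition residual i f : T -> R := fun x => f x - A i f x.

(** The factors commute only up to almost everywhere equality, so the product
is taken along a sequence. *)
Definition residuals r : (T -> R) -> (T -> R) :=
  \big[(fun B C => B \o C)/id]_(i <- r) residual i.

Lemma residuals_cons i r f : residuals (i :: r) f = residual i (residuals r f).
Proof. by rewrite /residuals big_cons. Qed.

Lemma Lp_linear_residual i : Lp_linear mu p (residual i).
Proof. exact: (Lp_linear_sub p1 (Lp_linear_id mu p)). Qed.

Lemma Lp_linear_residuals r : Lp_linear mu p (residuals r).
Proof.
rewrite /residuals; elim: r => [|i r IH].
  by rewrite big_nil; exact: Lp_linear_id.
rewrite big_cons; apply: (Lp_linear_comp p1) => //; exact: Lp_linear_residual.
Qed.

Lemma Lp_bounded_residuals r : Lp_bounded mu p (residuals r).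
Proof.
rewrite /residuals; elim: r => [|i r IH].
  by rewrite big_nil; exact: Lp_bounded_id.
rewrite big_cons; apply: Lp_bounded_comp => //; first exact: Lp_linear_residuals.
apply: (Lp_bounded_sub p1) => //; [exact: Lp_linear_id|exact: Lp_bounded_id].
Qed.

Let Ap i f : f \in Lfun mu p -> A i f \in Lfun mu p.
Proof. by case: (Alin i) => + _ _; exact. Qed.

Let Np i f : f \in Lfun mu p -> residual i f \in Lfun mu p.
Proof. by case: (Lp_linear_residual i) => + _ _; exact. Qed.

Let Pp r f : f \in Lfun mu p -> residuals r f \in Lfun mu p.
Proof. by case: (Lp_linear_residuals r) => + _ _; exact. Qed.

Lemma average_residual i f : f \in Lfun mu p ->
  A i (residual i f) = cst 0 %[ae mu].
Proof.
move=> fp; move: (Lp_linearB (Alin i) fp (Ap i fp)) (AK i fp).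
by apply: filterS2 => x /(_ Logic.I) -> /(_ Logic.I) -> _; rewrite subrr.
Qed.

Lemma residual_fixedP i f : A i f = cst 0 %[ae mu] <-> residual i f = f %[ae mu].
Proof.
split; apply: filterS => x /(_ Logic.I); rewrite /residual /cst.
  by move=> -> _; rewrite subr0.
by move=> + _ => /eqP; rewrite -subr_eq0 addrAC subrr add0r oppr_eq0 => /eqP.
Qed.

Lemma residualC i j f : f \in Lfun mu p ->
  residual i (residual j f) = residual j (residual i f) %[ae mu].
Proof.
move=> fp; have := AC i j fp.
move: (Lp_linearB (Alin i) fp (Ap j fp)) (Lp_linearB (Alin j) fp (Ap i fp)).
apply: filterS3 => x; rewrite /residual.
move=> /(_ Logic.I) -> /(_ Logic.I) -> /(_ Logic.I) -> _.
by ring.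
Qed.

(** A factor of the product may be commuted to the front, where it is absorbed
since the residual of a projection is a projection. *)
Lemma residual_residuals i r f : i \in r -> f \in Lfun mu p ->
  residual i (residuals r f) = residuals r f %[ae mu].
Proof.
move=> + fp; elim: r => [//|j r IH]; rewrite inE residuals_cons.
have [->|ij] := eqVneq i j => /=.
  by move=> _; apply/residual_fixedP/average_residual/Pp.
move=> ir; apply: ae_eq_trans (residualC i j (Pp r fp)) _.
by have [_ + _] := Lp_linear_residual j; apply; [exact/Np/Pp|exact: Pp|exact: IH].
Qed.

Lemma average_residuals i r f : i \in r -> f \in Lfun mu p ->
  A i (residuals r f) = cst 0 %[ae mu].
Proof. by move=> ir fp; apply/residual_fixedP/residual_residuals. Qed.

Lemma residuals_fixed r f : f \in Lfun mu p ->
  (forall i, i \in r -> A i f = cst 0 %[ae mu]) -> residuals r f = f %[ae mu].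
Proof.
move=> fp; elim: r => [_|i r IH Ar].
  by rewrite /residuals big_nil; exact: aeW.
have fi : residual i f = f %[ae mu] by apply/residual_fixedP/Ar; rewrite mem_head.
rewrite residuals_cons; apply: ae_eq_trans fi.
have [_ + _] := Lp_linear_residual i; apply => //; first exact: Pp.
by apply: IH => j jr; apply: Ar; rewrite inE jr orbT.
Qed.

Lemma residualsK r : Lp_idempotent mu p (residuals r).
Proof.
move=> f fp; apply: residuals_fixed; first exact: Pp.
by move=> i ir; exact: average_residuals.
Qed.

Lemma residuals_compl r f : f \in Lfun mu p ->
  residuals r (fun x => f x - residuals r f x) = cst 0 %[ae mu].
Proof.
move=> fp; move: (Lp_linearB (Lp_linear_residuals r) fp (Pp r fp)) (residualsK r fp).
by apply: filterS2 => x /(_ Logic.I) -> /(_ Logic.I) -> _; rewrite subrr.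
Qed.

Lemma compl_residuals r f : f \in Lfun mu p ->
  (fun x => residuals r f x - residuals r (residuals r f) x) = cst 0 %[ae mu].
Proof.
move=> fp; apply: filterS (residualsK r fp) => x /(_ Logic.I) -> _.
by rewrite subrr.
Qed.

Lemma compl_residuals_eq0P r f : f \in Lfun mu p ->
  (fun x => f x - residuals r f x) = cst 0 %[ae mu] <->
  forall i, i \in r -> A i f = cst 0 %[ae mu].
Proof.
move=> fp; split => [f0 i ir|Ar].
  apply: ae_eq_trans (average_residuals ir fp).
  have [_ + _] := Alin i; apply => //; first exact: Pp.
  by apply: filterS f0 => x /(_ Logic.I)/eqP; rewrite subr_eq0 => /eqP.
by apply: filterS (residuals_fixed fp Ar) => x /(_ Logic.I) -> _; rewrite subrr.
Qed.

Lemma Lp_projection_residuals r : Lp_projection mu p (residuals r).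
Proof.
split; [exact: Lp_linear_residuals|exact: Lp_bounded_residuals|exact: residualsK].
Qed.

Lemma Lp_projection_compl_residuals r :
  Lp_projection mu p (fun f x => f x - residuals r f x).
Proof.
have idl := Lp_linear_id mu p; have rl := Lp_linear_residuals r; split.
- exact: (Lp_linear_sub p1).
- apply: (Lp_bounded_sub p1) => //; first exact: Lp_bounded_id.
  exact: Lp_bounded_residuals.
- move=> f fp; apply: filterS (residuals_compl r fp) => x /(_ Logic.I) -> _.
  by rewrite subr0.
Qed.

End commuting_projections.

(** * Smooth cutoffs of one variable *)

Section flat_functions.
Context {R : realType}.

(** The powers of 1/x make the family closed under differentiation, up to linear
combinations. *)
Definition flat n (x : R) : R := if 0 < x then x^-1 ^+ n * expR (- x^-1) else 0.

Lemma flat_le0 n x : x <= 0 -> flat n x = 0.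
Proof. by rewrite /flat leNgt => /negbTE ->. Qed.

Lemma flat_gt0 n x : 0 < x -> flat n x = x^-1 ^+ n * expR (- x^-1).
Proof. by rewrite /flat => ->. Qed.

Lemma flat_ge0 n x : 0 <= flat n x.
Proof.
rewrite /flat; case: ifP => // x0.
by rewrite mulr_ge0 ?expR_ge0// exprn_ge0// invr_ge0 ltW.
Qed.

Lemma flat0_le1 x : flat 0 x <= 1.
Proof.
rewrite /flat; case: ifP => // x0.
by rewrite expr0 mul1r expR_le1 oppr_le0 invr_ge0 ltW.
Qed.

(** exp y dominates y^(n+1)/(n+1)!; take y = 1/x. *)
Lemma flat_le n x : flat n x <= n.+1`!%:R * `|x|.
Proof.
have [x0|x0] := leP x 0; first by rewrite flat_le0// mulr_ge0.
rewrite flat_gt0// gtr0_norm// expRN.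
have y0 : 0 < x^-1 by rewrite invr_gt0.
have := expR_ge1Dxn n (ltW y0); set y := x^-1 in y0 * => H.
have -> : x = y^-1 by rewrite /y invrK.
rewrite ler_pdivrMr ?expR_gt0// mulrAC ler_pdivlMr// -exprSr.
rewrite -ler_pdivrMl ?ltr0n ?fact_gt0// mulrC.
by apply: le_trans H; rewrite lerDr.
Qed.

Lemma flat_cvg0 n : flat n x @[x --> 0] --> (0 : R).
Proof.
apply/cvgr0Pnorm_le => e e0.
have c0 : 0 < (n.+1`!)%:R :> R by rewrite ltr0n fact_gt0.
apply: filterS (@nbhs0_le _ R^o _ (divr_gt0 e0 c0)) => x xe.
rewrite ger0_norm ?flat_ge0//.
by apply: le_trans (flat_le n x) _; rewrite mulrC -ler_pdivlMr.
Qed.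

(** At 0, the difference quotient of [flat n] is [flat n.+1], which tends to 0. *)
Lemma is_derive_flat n (x : R) :
  is_derive x 1 (flat n) (flat n.+2 x - n%:R * flat n.+1 x).
Proof.
have [x0|x0|->] := ltgtP x 0.
- rewrite !flat_le0 ?ltW// mulr0 subr0.
  apply: (@near_eq_is_derive _ _ _ (cst 0)).
  near=> y; rewrite flat_le0//; near: y; exact: lt_le_nbhsl.
- have nf : \forall y \near x, y^-1 ^+ n * expR (- y^-1) = flat n y.
    by near=> y; rewrite flat_gt0//; near: y; exact: lt_nbhsr.
  apply: (near_eq_is_derive nf); rewrite !flat_gt0//.
  have dV : is_derive x 1 (fun y : R => y^-1) (- x ^- 2 *: 1).
    by apply: (@is_deriveV _ id x 1 1); rewrite ?gt_eqF.
  have dN : is_derive x 1 (fun y : R => - y^-1) (- (- x ^- 2 *: 1)) by exact: is_deriveN.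
  have dE := @is_derive1_comp _ expR (fun y => - y^-1) x _ _ (is_derive_expR _) dN.
  have dX := is_deriveX n dV.
  have := is_deriveM dX dE.
  rewrite (_ : _ * _ = fun y => y^-1 ^+ n * expR (- y^-1)); last first.
    by apply/funext => y; rewrite /= !fctE.
  move=> dF; apply: is_derive_eq dF _.
  rewrite /GRing.scale/= !fctE !mulr1 opprK -!exprVn; set y := x^-1; set e := expR _.
  case: n {nf dX} => [|n] /=; first by ring.
  by rewrite /= !exprS; ring.
- have flatS : (fun h : R => h^-1 *: ((flat n \o shift 0) (h *: 1) - flat n 0)) @ 0^'
      --> (0 : R).
    rewrite (_ : (fun _ => _) = flat n.+1).
      by apply: cvg_trans (flat_cvg0 n.+1); apply: cvg_app; exact: cvg_within.
    apply/funext => h; rewrite /= (flat_le0 n (lexx 0)) subr0 addr0 /GRing.scale/= mulr1.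
    have [h0|h0] := leP h 0; first by rewrite !flat_le0// mulr0.
    by rewrite !flat_gt0// exprS mulrA.
  rewrite !flat_le0// mulr0 subr0.
  by apply: DeriveDef; [exact: cvgP flatS|exact: cvg_lim flatS].
Unshelve. all: by end_near. Qed.

(** Sums and products are constructors, so that stability under differentiation
is an induction; the products also provide the cutoffs. *)
Inductive flat_generated : (R -> R) -> Prop :=
| gen_flat n (u v : R) : flat_generated (fun t => flat n (u * t + v))
| gen_cst (c : R) : flat_generated (cst c)
| gen_add f g : flat_generated f -> flat_generated g -> flat_generated (f + g)
| gen_mul f g : flat_generated f -> flat_generated g -> flat_generated (f * g).

Lemma flat_generated_derive f : flat_generated f ->
  exists2 g, flat_generated g & forall t : R, is_derive t 1 f (g t).
Proof.
elim=> [n u v|c|{}f g _ [df gdf fdf] _ [dg gdg gdg']|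
    {}f g gf [df gdf fdf] gg [dg gdg gdg']].
- exists (((fun t => flat n.+2 (u * t + v)) +
    cst (- n%:R) * (fun t => flat n.+1 (u * t + v))) * cst u) => [|t].
    apply: gen_mul (gen_cst _); apply: gen_add (gen_flat _ _ _) _.
    exact: gen_mul (gen_cst _) (gen_flat _ _ _).
  have da : is_derive t 1 (fun t : R => u * t + v) u.
    have := is_deriveD (is_deriveZ u (is_derive_id t 1)) (is_derive_cst v t 1).
    by move=> h; apply: is_derive_eq h _; rewrite addr0 /GRing.scale/= mulr1.
  have := @is_derive1_comp _ (flat n) (fun t => u * t + v) t _ _
    (is_derive_flat _ _) da.
  by move=> h; apply: is_derive_eq h _; rewrite !fctE mulNr.
- by exists (cst 0) => [|t]; [exact: gen_cst|exact: is_derive_cst].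
- by exists (df + dg) => [|t]; [exact: gen_add|exact: is_deriveD].
- exists (f * dg + g * df) => [|t]; first by apply: gen_add; exact: gen_mul.
  exact: is_deriveM.
Qed.

Lemma flat_generated_continuous f : flat_generated f -> continuous f.
Proof.
move=> /flat_generated_derive[g _ fg] t.
by apply/differentiable_continuous/derivable1_diffP; case: (fg t).
Qed.

(** The shift by 1 moves the support away from a and b, to the interval
[a + 1/(k+1), b - 1/(k+1)]; the factor k+1 makes the cutoffs tend to 1 on
]a, b[, as exp(-1/y) tends to 1 when y tends to infinity. *)
Definition cutoff (a b : R) (k : nat) (t : R) : R :=
  flat 0 (k.+1%:R * (t - a) - 1) * flat 0 (k.+1%:R * (b - t) - 1).

Lemma cutoff_generated a b k : flat_generated (cutoff a b k).
Proof.
rewrite (_ : cutoff a b k = (fun t => flat 0 (k.+1%:R * t + (- (k.+1%:R * a) - 1))) *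
  (fun t => flat 0 (- k.+1%:R * t + (k.+1%:R * b - 1)))).
  by apply: gen_mul; exact: gen_flat.
by apply/funext => t; rewrite fctE /cutoff; congr (flat _ _ * flat _ _); ring.
Qed.

Lemma cutoff_ge0 a b k t : 0 <= cutoff a b k t.
Proof. by rewrite mulr_ge0// flat_ge0. Qed.

Lemma cutoff_le1 a b k t : cutoff a b k t <= 1.
Proof. by rewrite mulr_ile1// ?flat_ge0// flat0_le1. Qed.

Lemma cutoff_neq0 a b k t : cutoff a b k t != 0 ->
  a + k.+1%:R^-1 <= t <= b - k.+1%:R^-1.
Proof.
have k0 : 0 < k.+1%:R :> R by rewrite ltr0n.
rewrite /cutoff mulf_eq0 negb_or => /andP[fa fb]; apply/andP; split.
  rewrite leNgt; apply: contra fa => tk; rewrite flat_le0// subr_le0.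
  by rewrite mulrC -ler_pdivlMr// div1r lerBlDl ltW.
rewrite leNgt; apply: contra fb => tk; rewrite flat_le0// subr_le0.
by rewrite mulrC -ler_pdivlMr// div1r lerBlDl -lerBlDr ltW.
Qed.

Lemma flat0_cvg1 (c : R) : 0 < c ->
  flat 0 (k.+1%:R * c - 1) @[k --> \oo] --> (1 : R).
Proof.
move=> c0; apply/cvgrPdist_le => e e0; near=> k.
set y := _ - 1; rewrite ger0_norm ?subr_ge0 ?flat0_le1//.
have ky : e^-1 <= y.
  rewrite /y lerBrDr -ler_pdivrMr//; apply: (@le_trans _ _ k%:R); last by rewrite ler_nat.
  by near: k; exact: nbhs_infty_ger.
have y0 : 0 < y by apply: lt_le_trans ky; rewrite invr_gt0.
rewrite flat_gt0// expr0 mul1r lerBlDr -lerBlDl.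
apply: le_trans (expR_ge1Dx _); rewrite lerD2l lerN2.
by rewrite -[leRHS]invrK lef_pV2// posrE ?invr_gt0.
Unshelve. all: by end_near. Qed.

Lemma cutoff_cvg1 a b t : a < t < b -> cutoff a b k t @[k --> \oo] --> (1 : R).
Proof.
move=> /andP[at_ tb]; rewrite -[1]mulr1.
by apply: cvgM; apply: flat0_cvg1; rewrite subr_gt0.
Qed.

End flat_functions.

(** * Functions on the box *)

Section line_derivative.
Context {R : realType} {V W : normedModType R}.

(** A directional derivative only depends on the restriction to a line. *)
Lemma is_derive_line (F : V -> R) (G : W -> R) (x v : V) (y w : W) (c dG : R) :
  (forall h : R, F (h *: v + x) = c * G (h *: w + y)) ->
  is_derive y w G dG -> is_derive x v F (c * dG).
Proof.
move=> FG [dGy <-].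
have FGx : F x = c * G y by have := FG 0; rewrite !scale0r !add0r.
have cvgF : (fun h => h^-1 *: ((F \o shift x) (h *: v) - F x)) @ 0^' -->
    (c * 'D_w G y : R).
  rewrite (_ : (fun _ => _) =
      (fun h => c * (h^-1 *: ((G \o shift y) (h *: w) - G y)))).
    by apply: cvgMl_tmp; exact: dGy.
  by apply/funext => h; rewrite /= FG FGx /GRing.scale/=; ring.
by apply: DeriveDef; [exact: cvgP cvgF|exact: cvg_lim cvgF].
Qed.

End line_derivative.

Section continuous_rV.
Context {R : realType} {d : nat}.

Lemma cvg_rV (T : Type) (F : set_system T) {FF : Filter F}
    (f : T -> 'rV[R]_d) (x : 'rV[R]_d) :
  (forall i, f y ord0 i @[y --> F] --> x ord0 i) -> f y @[y --> F] --> x.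
Proof.
move=> fx; apply/cvg_ballP => e e0.
have H (i : 'I_d) : \forall y \near F, ball (x ord0 i) e (f y ord0 i).
  by have /cvg_ballP := fx i; apply.
have : \forall y \near F, forall i, ball (x ord0 i) e (f y ord0 i).
  exact: filter_forall.
by apply: filterS => y Hy; split => // i j; rewrite (ord1 i); exact: Hy.
Qed.

Lemma continuous_set_coord i (s : R) :
  continuous (fun x : 'rV[R]_d => set_coord x i s).
Proof.
move=> x; apply: (@cvg_rV _ (nbhs x) _) => j; rewrite [X in X @ _](_ : _ =
    if j == i then cst s else (fun x : 'rV[R]_d => x ord0 j)).
  by rewrite mxE; case: ifP => _; [exact: cvg_cst|exact: coord_continuous].
by apply/funext => y; rewrite mxE; case: ifP.
Qed.

Lemma continuous_comp_set_coord i (s : R) (v : 'rV[R]_d -> R) :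
  continuous v -> continuous (fun x => v (set_coord x i s)).
Proof.
move=> cv x.
have := @continuous_comp _ _ _ (fun y : 'rV[R]_d => set_coord y i s) v x.
by apply; [exact: continuous_set_coord|exact: cv].
Qed.

Lemma continuous_comp_coord i (g : R -> R) :
  continuous g -> continuous (fun x : 'rV[R]_d => g (x ord0 i)).
Proof.
move=> cg x; have := @continuous_comp _ _ _ (fun y : 'rV[R]_d => y ord0 i) g x.
by apply; [exact: coord_continuous|exact: cg].
Qed.

Lemma continuous_set_coordr i (x : 'rV[R]_d) : continuous (set_coord x i).
Proof.
move=> t; apply: (@cvg_rV _ (nbhs t) _) => j; rewrite [X in X @ _](_ : _ =
    if j == i then id else cst (x ord0 j)).
  by rewrite mxE; case: ifP => _; [exact: cvg_id|exact: cvg_cst].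
by apply/funext => y; rewrite mxE; case: ifP.
Qed.

Let round (n : nat) (t : R) : R := (Num.floor (n.+1%:R * t))%:~R / n.+1%:R.

Let round_le n t : `|t - round n t| <= n.+1%:R^-1.
Proof.
have n0 : 0 < n.+1%:R :> R by rewrite ltr0n.
have /andP[l u] := real_floor_itv (num_real (n.+1%:R * t)).
have -> : t - round n t = (n.+1%:R * t - (Num.floor (n.+1%:R * t))%:~R) / n.+1%:R.
  by rewrite /round mulrBl mulrAC divff ?mul1r// gt_eqF.
rewrite normrM normfV (ger0_norm (ltW n0)); apply: ler_piMl; first by rewrite invr_ge0 ltW.
by rewrite ger0_norm ?subr_ge0// lerBlDl ltW//; move: u; rewrite intrD.
Qed.

Let measurable_round_fibre n (m : int) :
  measurable [set t : R | Num.floor (n.+1%:R * t) = m].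
Proof.
have n0 : 0 < n.+1%:R :> R by rewrite ltr0n.
rewrite (_ : [set t | _] = `[m%:~R / n.+1%:R, (m + 1)%:~R / n.+1%:R[%classic)//.
apply/seteqP; split => t /=; rewrite in_itv/= ler_pdivrMr// ltr_pdivlMr// mulrC.
  by move=> <-; exact/real_floor_itv/num_real.
exact: floor_def.
Qed.

(** The measurable sets are those of the product sigma-algebra, while continuity
refers to the norm topology. A continuous function is the limit of its
compositions with roundings of the coordinates, which take countably many
values, each of them on a rectangle. *)
Lemma continuous_measurable_rV (f : 'rV[R]_d -> R) : continuous f ->
  measurable_fun setT f.
Proof.
move=> cf; pose rd n (x : 'rV[R]_d) : 'rV[R]_d := \row_j round n (x ord0 j).
apply: (@measurable_fun_cvg _ _ _ setT (fun n x => f (rd n x))) => [n|x _].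
  move=> _ Y mY; rewrite setTI.
  pose C (z : 'rV[int]_d) :=
    rectangle (fun j => [set t : R | Num.floor (n.+1%:R * t) = z ord0 j]).
  pose D (z : 'rV[int]_d) := [set x : 'rV[R]_d | C z x /\ Y (f (rd n x))].
  rewrite (_ : _ @^-1` Y = \bigcup_z D z); last first.
    apply/seteqP; split => x /=; last by case=> z _ [].
    move=> Yx; exists (\row_j Num.floor (n.+1%:R * x ord0 j)) => //.
    by split=> // j; rewrite /= mxE.
  apply: countable_bigcupT_measurable => // z.
  have mC : measurable (C z).
    by apply: measurable_rectangle => j; exact: measurable_round_fibre.
  have [Yz|nYz] := pselect (Y (f (\row_j ((z ord0 j)%:~R / n.+1%:R)))).
    rewrite (_ : D z = C z)//; apply/seteqP; split => x; first by case.
    move=> Cx; split => //; rewrite (_ : rd n x = \row_j ((z ord0 j)%:~R / n.+1%:R))//.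
    by apply/rowP => j; rewrite !mxE /round Cx.
  rewrite (_ : D z = set0)//; apply/seteqP; split => x // [Cx].
  rewrite (_ : rd n x = \row_j ((z ord0 j)%:~R / n.+1%:R))//.
  by apply/rowP => j; rewrite !mxE /round Cx.
apply: (@cvg_comp _ _ _ (rd ^~ x) f) (cf x).
apply: (@cvg_rV _ (nbhs \oo) _) => j; apply/cvgrPdist_le => e e0; near=> n.
rewrite mxE; apply: le_trans (round_le _ _) _.
by near: n; apply: filterS (near_infty_natSinv_lt (PosNum e0)) => n /ltW.
Unshelve. all: by end_near. Qed.

End continuous_rV.

Section box_topology.
Context {R : realType} {d : nat}.
Variables a b : 'I_d -> R.

Lemma set_coord_id (x : 'rV[R]_d) i : set_coord x i (x ord0 i) = x.
Proof. by apply/rowP => j; rewrite mxE; case: eqP => [->|]. Qed.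

Lemma interior_boxP (x : 'rV[R]_d) :
  interior (box a b) x <-> forall i, a i < x ord0 i < b i.
Proof.
split => [bx i|abx].
  have : interior `[a i, b i]%classic (x ord0 i).
    have cx := @continuous_set_coordr R d i x (x ord0 i).
    rewrite /continuous_at set_coord_id in cx.
    have : \forall t \near x ord0 i, box a b (set_coord x i t) by exact: cx bx.
    rewrite /interior; apply: filterS => t /(_ i); rewrite mxE eqxx.
    by rewrite /= in_itv.
  by rewrite interior_itv /= in_itv.
have near_i i : \forall y \near (x : 'rV[R]_d), a i < (y : 'rV[R]_d) ord0 i < b i.
  have nab : nbhs (x ord0 i) `]a i, b i[%classic.
    by apply: open_nbhs_nbhs; split; [exact: itv_open|rewrite /= in_itv/=; exact: abx].
  have : \forall y \near x, `]a i, b i[%classic ((y : 'rV[R]_d) ord0 i).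
    exact: (@coord_continuous R 1 d ord0 i x) nab.
  by apply: filterS => y; rewrite /= in_itv.
have : \forall y \near (x : 'rV[R]_d), forall i, a i < (y : 'rV[R]_d) ord0 i < b i.
  exact: (@filter_forall _ _ (fun i (y : 'rV[R]_d) => a i < y ord0 i < b i)
    (nbhs x) _ near_i).
by rewrite /interior; apply: filterS => y yab i; have /andP[? ?] := yab i; rewrite !ltW.
Qed.

Lemma compact_box : compact (box a b).
Proof.
rewrite (_ : box a b = [set v | forall i, `[a i, b i]%classic (v ord0 i)]).
  apply: (@rV_compact R d (fun i => `[a i, b i]%classic)) => i; exact: segment_compact.
by apply/seteqP; split => x H i; have := H i; rewrite /= in_itv.
Qed.

Lemma continuous_bounded_box (f : 'rV[R]_d -> R) : continuous f ->
  exists M : R, forall x, box a b x -> `|f x| <= M.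
Proof.
move=> cf.
have : compact (f @` box a b).
  by apply: continuous_compact compact_box; exact: continuous_subspaceT.
move=> /compact_bounded[M [_ HM]]; exists (M + 1) => x bx.
by apply: (HM (M + 1)); [rewrite ltrDl|exists x].
Qed.

End box_topology.

Section smooth_products.
Context {R : realType} {d : nat}.
Implicit Types (psi : 'rV[R]_d -> R) (i k : 'I_d) (g : R -> R).

Lemma set_coord_line k i (h s : R) (x : 'rV[R]_d) :
  set_coord (h *: delta_mx ord0 k + x) i s =
  if k == i then set_coord x i s
  else h *: delta_mx ord0 k + set_coord x i s.
Proof.
apply/rowP => j; case: eqP => [->|/eqP ki]; rewrite !mxE ?eqxx /=.
  by case: eqP => // _; rewrite mulr0 add0r.
by case: eqP => [->|//]; rewrite eq_sym (negbTE ki) mulr0 add0r.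
Qed.

Lemma is_derive_set_coord_mul k i (s : R) (u : 'rV[R]_d -> R) g (dg : R -> R)
    (x : 'rV[R]_d) :
  (forall y, derivable u y (delta_mx ord0 k)) ->
  (forall t : R, is_derive t 1 g (dg t)) ->
  is_derive x (delta_mx ord0 k)
    (fun y => u (set_coord y i s) * g (y ord0 i))
    (if k == i then u (set_coord x i s) * dg (x ord0 i)
     else partial k u (set_coord x i s) * g (x ord0 i)).
Proof.
move=> du dgP; case: eqP => [->|/eqP ki].
  apply: (@is_derive_line _ _ R^o _ g _ _ (x ord0 i) 1) => // h.
  rewrite set_coord_line eqxx !mxE !eqxx /=; congr (_ * g _).
rewrite mulrC.
apply: (@is_derive_line _ _ _ _ u _ _ (set_coord x i s) (delta_mx ord0 k)) => [h|].
  rewrite set_coord_line (negbTE ki) !mxE eqxx /= eq_sym (negbTE ki) mulr0 add0r.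
  exact: mulrC.
exact: derivableP.
Qed.

(** A partial derivative in direction i only hits the second factor, the other
ones only hit the first factor. *)
Lemma foldr_partial_set_coord_mul i (s : R) psi g (l : seq 'I_d) :
  smooth psi -> flat_generated g ->
  exists l' g', flat_generated g' /\
    foldr (@partial R d) (fun x => psi (set_coord x i s) * g (x ord0 i)) l =
    (fun x => foldr (@partial R d) psi l' (set_coord x i s) * g' (x ord0 i)).
Proof.
move=> spsi gg; elim: l => [|k l [l' [g' [gg' E]]]] /=; first by exists [::], g.
rewrite E.
have [dg gdg gdgP] := flat_generated_derive gg'.
exists (if k == i then l' else k :: l'), (if k == i then dg else g'); split.
  by case: ifP.
apply/funext => x.
have := @is_derive_set_coord_mul k i s _ _ _ x ((spsi l').2 k) gdgP.
by rewrite /partial => /@derive_val ->; case: ifP.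
Qed.

Lemma smooth_set_coord_mul i (s : R) psi g : smooth psi -> flat_generated g ->
  smooth (fun x => psi (set_coord x i s) * g (x ord0 i)).
Proof.
move=> spsi gg l.
have [l' [g' [gg' E]]] := @foldr_partial_set_coord_mul i s psi g l spsi gg.
rewrite [foldr _ _ _]E.
have cu := @continuous_comp_set_coord R d i s _ (spsi l').1.
have cg := @continuous_comp_coord R d i _ (flat_generated_continuous gg').
split => [x|k x]; first exact: (continuousM (cu x) (cg x)).
have [dg _ gdgP] := flat_generated_derive gg'.
by have [] := @is_derive_set_coord_mul k i s _ _ _ x ((spsi l').2 k) gdgP.
Qed.

End smooth_products.

(** * Test functions *)

Section test_functions.
Context {R : realType} {d : nat}.
Variables a b : 'I_d -> R.

(** The first factor keeps the other coordinates in the interior of the box, the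
cutoff keeps the i-th one there. *)
Lemma test_function_cutoff i (s : R) (k : nat) (psi : 'rV[R]_d -> R) :
  test_function a b psi ->
  test_function a b
    (fun x => psi (set_coord x i s) * cutoff (a i) (b i) k (x ord0 i)).
Proof.
move=> [spsi _ Ksub]; set K := closure _ in Ksub.
set Psi := fun x : 'rV[R]_d => _.
pose e : R := k.+1%:R^-1.
pose Z := [set x : 'rV[R]_d | K (set_coord x i s) /\ a i + e <= x ord0 i <= b i - e].
have Zc : closed Z.
  have cs := @continuous_set_coord R d i s.
  rewrite (_ : Z = (fun x => set_coord x i s) @^-1` K `&`
      (fun x : 'rV[R]_d => x ord0 i) @^-1` `[a i + e, b i - e]%classic).
    apply: closedI; apply: preimage_closed.
    - by move=> x _; exact: cs.
    - exact: closed_closure.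
    - by move=> x _; exact: coord_continuous.
    - exact: itv_closed.
  by apply/seteqP; split => x [? H]; split; rewrite //= ?in_itv//; move: H; rewrite /= in_itv.
have suppZ : closure [set x | Psi x != 0] `<=` Z.
  rewrite closureE; apply: smallest_sub => // x /=.
  rewrite /Psi mulf_eq0 negb_or => /andP[px /cutoff_neq0 cx]; split => //.
  exact: subset_closure.
have Zint : Z `<=` interior (box a b).
  move=> x [/Ksub/interior_boxP Kx /andP[ax xb]]; apply/interior_boxP => j.
  have e0 : 0 < e by rewrite invr_gt0 ltr0n.
  have := Kx j; rewrite mxE; case: eqP => [-> _|//].
  by rewrite (lt_le_trans _ ax) ?ltrDl// (le_lt_trans xb)// ltrBlDr ltrDl.
split.
- by apply: smooth_set_coord_mul => //; exact: cutoff_generated.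
- apply: (subclosed_compact _ (@compact_box R d a b)); first exact: closed_closure.
  by move=> x /suppZ/Zint/interior_subset.
- by move=> x /suppZ/Zint.
Qed.

Lemma partial_cutoff i j (s : R) (k : nat) (psi : 'rV[R]_d -> R) x : j != i ->
  smooth psi ->
  partial j (fun x => psi (set_coord x i s) * cutoff (a i) (b i) k (x ord0 i)) x =
  partial j psi (set_coord x i s) * cutoff (a i) (b i) k (x ord0 i).
Proof.
move=> ji spsi.
have [dg _ gdgP] := flat_generated_derive (cutoff_generated (a i) (b i) k).
have := @is_derive_set_coord_mul _ _ j i s _ _ _ x ((spsi [::]).2 j) gdgP.
by rewrite (negbTE ji) => /@derive_val.
Qed.

Lemma test_function_boundary psi x : test_function a b psi ->
  ~ interior (box a b) x -> psi x = 0.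
Proof.
move=> [_ _ Ksub] xint; apply/eqP; apply: contrapT => /negP px; apply: xint.
by apply/Ksub/subset_closure.
Qed.

(** The fundamental theorem of calculus, the boundary values being zero. *)
Lemma integral_partial_fibre i psi (x : 'rV[R]_d) : a i < b i ->
  test_function a b psi ->
  \int[lebesgue_measure]_(t in `[a i, b i]) partial i psi (set_coord x i t) = 0.
Proof.
move=> ab tpsi; have [spsi _ _] := tpsi.
pose F t := psi (set_coord x i t).
have dF (t : R) : is_derive t 1 F (partial i psi (set_coord x i t)).
  rewrite -[partial _ _ _]mul1r.
  apply: (@is_derive_line _ _ _ F psi _ _ (set_coord x i t) (delta_mx ord0 i)).
    move=> h; rewrite mul1r /F; congr psi; apply/rowP => j; rewrite !mxE eqxx /=.
    by case: eqP => _; rewrite /GRing.scale/= ?mulr1 ?mulr0 ?add0r.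
  exact: derivableP ((spsi [::]).2 i _).
have cF : continuous F.
  by move=> t; apply/differentiable_continuous/derivable1_diffP; case: (dF t).
rewrite /Rintegral (@continuous_FTC2 _ _ F)//.
- rewrite /F !(test_function_boundary tpsi)//.
  + by rewrite subee.
  + by move=> /interior_boxP/(_ i); rewrite mxE eqxx ltxx.
  + by move=> /interior_boxP/(_ i); rewrite mxE eqxx ltxx andbF.
- apply: continuous_subspaceT => t.
  have := @continuous_comp _ _ _ (set_coord x i) (partial i psi) t.
  apply; [exact: continuous_set_coordr|exact: (spsi [:: i]).1].
- split.
  + by move=> t _; case: (dF t).
  + exact/cvg_at_right_filter/cF.
  + exact/cvg_at_left_filter/cF.
- by move=> t _; rewrite derive1E; case: (dF t).
Qed.

End test_functions.

(** * Integrals of products of bounded functions *)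

Section Lfun_infty.
Context d (T : measurableType d) (R : realType).
Variable mu : {finite_measure set T -> \bar R}.
Implicit Types f g : T -> R.

Lemma Lfun_inftyI f (M : R) : measurable_fun setT f ->
  {ae mu, forall x, `|f x| <= M} -> f \in Lfun mu +oo%E.
Proof.
move=> mf fM; apply/andP; split; rewrite inE//= /finite_norm unlock /Lnorm.
case: ifPn => // _; apply: (@le_lt_trans _ _ M%:E); last by rewrite ltry.
by apply/ess_supP; apply: filterS fM => x; rewrite /= lee_fin.
Qed.

Lemma Lfun_infty_bounded f : f \in Lfun mu +oo%E ->
  exists2 M : R, 0 <= M & {ae mu, forall x, `|f x| <= M}.
Proof.
move=> /andP[_ /[!inE]/=]; rewrite /finite_norm unlock /Lnorm.
case: ifPn => [_ /ess_supr_bounded[M fM]|mu0 _].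
  exists `|M| => //; apply: filterS fM => x /le_trans; apply; exact: ler_norm.
exists 0 => //; apply: measure0_ae; apply/eqP.
by rewrite eq_le measure_ge0 andbT leNgt.
Qed.

Lemma Lfun_inftyM f g : f \in Lfun mu +oo%E -> g \in Lfun mu +oo%E ->
  (fun x => f x * g x) \in Lfun mu +oo%E.
Proof.
move=> fp gp; have mf := Lfun_measurable fp; have mg := Lfun_measurable gp.
have [M M0 fM] := Lfun_infty_bounded fp; have [N N0 gN] := Lfun_infty_bounded gp.
apply: (@Lfun_inftyI _ (M * N)); first exact: measurable_funM.
by move: fM gN; apply: filterS2 => x fx gx; rewrite normrM ler_pM.
Qed.

Lemma Lfun_integrable1 (p : \bar R) f : (1 <= p)%E -> f \in Lfun mu p ->
  mu.-integrable setT (EFin \o f).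
Proof.
move=> p1 fp; apply/Lfun1_integrable.
by apply: (Lfun_subset (lexx _) p1) fp => //; exact: fin_num_measure.
Qed.

Lemma RintegralM_sub f g h : f \in Lfun mu +oo%E -> g \in Lfun mu +oo%E ->
  h \in Lfun mu +oo%E ->
  \int[mu]_x ((f x - g x) * h x) = \int[mu]_x (f x * h x) - \int[mu]_x (g x * h x).
Proof.
move=> fp gp hp; rewrite -RintegralB//.
- by apply: eq_Rintegral => x _; rewrite mulrBl.
- exact: (Lfun_integrable1 (leey 1%E) (Lfun_inftyM fp hp)).
- exact: (Lfun_integrable1 (leey 1%E) (Lfun_inftyM gp hp)).
Qed.

(** Dominated convergence for multipliers in [0, 1] tending to 1. *)
Lemma cvg_Rintegral_multiplier f (chi : nat -> T -> R) :
  mu.-integrable setT (EFin \o f) ->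
  (forall k, measurable_fun setT (chi k)) ->
  (forall k x, 0 <= chi k x <= 1) ->
  {ae mu, forall x, chi k x @[k --> \oo] --> (1 : R)} ->
  \int[mu]_x (f x * chi k x) @[k --> \oo] --> \int[mu]_x f x.
Proof.
move=> intf mchi chi01 chi1; have /measurable_EFinP mf := measurable_int mu intf.
have [] := @dominated_convergence _ _ _ mu setT measurableT
  (fun k x => (f x * chi k x)%:E) (EFin \o f) (fun x => `|f x|%:E).
- by move=> k; apply/measurable_EFinP; exact: measurable_funM.
- exact/measurable_EFinP.
- apply: filterS chi1 => x cx _; apply: cvg_EFin; first exact: nearW.
  by rewrite -[X in _ --> X]mulr1; apply: cvgM => //; exact: cvg_cst.
- by move/integrable_norm : intf.
- apply: aeW => x k _; rewrite /= lee_fin normrM ler_piMr//.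
  by have /andP[? ?] := chi01 k x; rewrite ger0_norm.
move=> _ _ cvgf; apply: fine_cvg; rewrite /Rintegral fineK//.
exact: integrable_fin_num.
Qed.

End Lfun_infty.

Section average_kernel.
Context d d' (T : measurableType d) (U : measurableType d') (R : realType).
Variables (mu : {finite_measure set T -> \bar R}) (P : probability U R).
Variable Phi : T * U -> T.
Hypothesis mPhi : measurable_fun setT Phi.
Hypothesis PhiE : forall A, measurable A -> (mu \x P)%E (Phi @^-1` A) = mu A.

(** Fubini's theorem for u(x) v(Phi (x, t)), which is integrable because u is
bounded and the averages of |v| have the same integral as |v|. *)
Lemma Rintegral_mul_average (u v : T -> R) :
  u \in Lfun mu +oo%E -> v \in Lfun mu +oo%E ->
  \int[mu]_x (u x * average P Phi v x) =
  \int[P]_t \int[mu]_x (u x * v (Phi (x, t))).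
Proof.
move=> up vp; have mu_ := Lfun_measurable up; have mv := Lfun_measurable vp.
have [M M0 uM] := Lfun_infty_bounded up.
have intv := Lfun_integrable1 (leey 1%E) vp.
have muv : measurable_fun setT (fun z : T * U => u z.1 * v (Phi z)).
  apply: measurable_funM; first by apply: (measurableT_comp mu_); exact: measurable_fst.
  exact: measurableT_comp mPhi.
have intuv : (mu \x P)%E.-integrable setT (EFin \o (fun z => u z.1 * v (Phi z))).
  have mav : measurable_fun setT (fun x => `|v x|%:E).
    by apply/measurable_EFinP; exact: measurableT_comp.
  apply/(integrable12ltyP mu P); first exact/measurable_EFinP.
  apply: (@le_lt_trans _ _ (\int[mu]_x (M%:E * \int[P]_t `|v (Phi (x, t))|%:E))%E).
    apply: ae_ge0_le_integral => //.
    - by move=> x _; exact: integral_ge0.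
    - apply: (@measurable_fun_fubini_tonelli_F _ _ _ _ _ P
        (fun z => `|(u z.1 * v (Phi z))%:E|%E)).
        by apply: measurableT_comp => //; exact/measurable_EFinP.
      by move=> z; exact: abse_ge0.
    - by move=> x _; rewrite mule_ge0 ?lee_fin// integral_ge0// => t _; rewrite lee_fin.
    - apply: measurable_funeM; apply: (measurable_average_ge0 P mPhi mav).
      by move=> x; rewrite lee_fin.
    apply: filterS uM => x ux _; rewrite -ge0_integralZl//; last first.
      exact: (measurable_section mPhi x mav).
    apply: ge0_le_integral => //.
    - apply/measurable_EFinP; apply: measurableT_comp => //.
      exact: (measurable_funM (measurable_cst (u x)) (measurable_section mPhi x mv)).
    - apply: measurable_funeM; exact: (measurable_section mPhi x mav).
    - by move=> t _; rewrite /= normrM lee_fin ler_wpM2r.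
  rewrite ge0_integralZl//.
  - rewrite (average_tonelli mPhi PhiE mav); last by move=> x; rewrite lee_fin.
    rewrite lte_mul_pinfty ?lee_fin//; move/integrableP : intv => [_].
    by under eq_integral do rewrite /=.
  - by apply: (measurable_average_ge0 P mPhi mav) => x; rewrite lee_fin.
  - by move=> x _; apply: integral_ge0 => t _; rewrite lee_fin.
rewrite -(Rintegral_Fubini intuv).
congr fine; apply: ae_eq_integral => //.
- apply/measurable_EFinP; apply: measurable_funM => //; exact: measurable_average.
- apply/measurable_EFinP; apply: (measurableT_comp (fine_measurable measurableT)).
  exact: (measurable_fubini_F intuv).
apply: filterS (ae_integrable_section mPhi PhiE intv) => x vx _; congr EFin.
by rewrite /= -RintegralZl.
Qed.

End average_kernel.

(** * The coordinate averages *)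

Section coordinate_averages.
Context {R : realType} {d : nat}.
Variables a b : 'I_d -> R.
Hypothesis hab : forall i, a i < b i.

Local Notation mu := (fin_box_measure hab).
Local Notation P := (fibre_prob hab).
Implicit Types (f g psi : 'rV[R]_d -> R) (i j : 'I_d) (p : \bar R).

Let mPhi i := @measurable_insert_coord R d i.
Let PhiE i A := @insert_coord_invariant R d a b hab i A.
Let avgE i f := @avgE R d a b hab i f.

Lemma Lp_linear_avg p i : (1 <= p)%E -> Lp_linear mu p (avg a b i).
Proof.
move=> p1; split => [f fp|f g fp gp fg|k f g fp gp].
- rewrite avgE; last exact: Lfun_measurable fp.
  exact: (@Lfun_average _ _ _ _ _ mu (P i) _ (mPhi i) (@PhiE i)).
- have mf := Lfun_measurable fp; have mg := Lfun_measurable gp.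
  by rewrite !avgE//; exact: (@ae_eq_average _ _ _ _ _ mu (P i) _ (mPhi i) (@PhiE i)).
- have mf := Lfun_measurable fp; have mg := Lfun_measurable gp.
  rewrite !avgE//; last exact: Lfun_measurable (Lfun_lin p1 k fp gp).
  apply: (@ae_average_linear _ _ _ _ _ mu (P i) _ (mPhi i) (@PhiE i)).
    exact: Lfun_integrable1 fp.
  exact: Lfun_integrable1 gp.
Qed.

Lemma Lp_contraction_avg p i : (1 <= p)%E -> Lp_contraction mu p (avg a b i).
Proof.
move=> p1 f fp; have mf := Lfun_measurable fp.
by rewrite avgE//; exact: (@Lnorm_average _ _ _ _ _ mu (P i) _ (mPhi i) (@PhiE i)).
Qed.

Lemma Lp_bounded_avg p i : (1 <= p)%E -> Lp_bounded mu p (avg a b i).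
Proof.
by move=> p1; exists 1 => f fp; rewrite mul1e; exact: Lp_contraction_avg.
Qed.

Lemma avgK p i f : (1 <= p)%E -> f \in Lfun mu p ->
  avg a b i (avg a b i f) = avg a b i f.
Proof.
move=> p1 fp; have mf := Lfun_measurable fp.
rewrite !avgE//; first exact: (@averageK _ _ _ _ _ (P i) _ (@insert_coordK R d i)).
exact: (@measurable_average _ _ _ _ _ (P i) _ (mPhi i)).
Qed.

Lemma avgC p i j f : (1 <= p)%E -> f \in Lfun mu p ->
  avg a b i (avg a b j f) = avg a b j (avg a b i f) %[ae mu].
Proof.
move=> p1 fp; have mf := Lfun_measurable fp.
have [->|ij] := eqVneq i j; first exact: aeW.
rewrite !avgE//; try exact: (@measurable_average _ _ _ _ _ (P _) _ (mPhi _)).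
apply: (@ae_average_commute _ _ _ _ _ _ _ mu (P i) (P j) _ _
  (mPhi i) (mPhi j) (@PhiE i) (@PhiE j)).
  by move=> x s t; exact: insert_coordC.
exact: Lfun_integrable1 fp.
Qed.

Lemma calPE (I : {set 'I_d}) :
  calP a b I = residuals (avg a b) [seq i <- index_enum 'I_d | i \in I].
Proof. by rewrite /calP /residuals big_filter. Qed.

(** A face of the box is null: the i-th coordinate may be resampled uniformly
([insert_coord_invariant]), and a uniform variable avoids both end points. *)
Lemma ae_interior_box : {ae mu, forall x, interior (box a b) x}.
Proof.
have aei i : {ae mu, forall x : 'rV[R]_d, a i < x ord0 i < b i}.
  pose N := (fun x : 'rV[R]_d => x ord0 i) @^-1` (~` `]a i, b i[%classic).
  have mN : measurable N.
    rewrite -[X in measurable X]setTI; apply: measurable_coord => //.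
    exact: measurableC.
  exists N; split; [exact: mN| |by move=> x /= H; rewrite /N/= in_itv].
  rewrite -(PhiE i mN); rewrite (_ : _ @^-1` N = setT `*` (~` `]a i, b i[%classic)).
    rewrite product_measure1E//; last exact: measurableC.
    rewrite [X in (_ * X)%E](_ : _ = 0%E) ?mule0//.
    rewrite [LHS](fibre_probE hab i); last exact: measurableC.
    rewrite [X in (_ * X)%E](_ : _ = 0%E) ?mule0//.
    apply/eqP; rewrite -measure_le0.
    apply: (@le_trans _ _ (lebesgue_measure [set a i; b i])).
      apply: le_measure; rewrite ?inE; first by apply: measurableI => //; exact: measurableC.
        by apply: measurableU; exact: measurable_set1.
      move=> t [] /=; rewrite !in_itv/= => /negP; rewrite negb_and -!leNgt.
      move=> /orP[ta|bt] /andP[at_ tb]; [left|right]; apply/eqP.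
        by rewrite eq_le ta at_.
      by rewrite eq_le tb bt.
    by rewrite countable_lebesgue_measure0//; apply: finite_set_countable; exact: finite_set2.
  by apply/seteqP; split; move=> [x t]; rewrite /N /= mxE eqxx//; case.
have : {ae mu, forall x : 'rV[R]_d, forall i, a i < x ord0 i < b i}.
  exact: (filter_forall (f := fun i (x : 'rV[R]_d) => a i < x ord0 i < b i)).
by apply: filterS => x /interior_boxP.
Qed.

Lemma Lfun_infty_continuous f : continuous f -> f \in Lfun mu +oo%E.
Proof.
move=> cf; have [M fM] := @continuous_bounded_box R d a b f cf.
apply: (@Lfun_inftyI _ _ _ _ _ M); first exact: continuous_measurable_rV.
by apply: filterS ae_interior_box => x /interior_subset/fM.
Qed.

Lemma Lfun_infty_test psi : test_function a b psi ->
  psi \in Lfun mu +oo%E /\ forall i, partial i psi \in Lfun mu +oo%E.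
Proof.
move=> [spsi _ _]; split=> [|i]; apply: Lfun_infty_continuous.
  exact: (spsi [::]).1.
exact: (spsi [:: i]).1.
Qed.

Lemma Rintegral_avg_sym i f g : f \in Lfun mu +oo%E -> g \in Lfun mu +oo%E ->
  \int[mu]_x (avg a b i f x * g x) = \int[mu]_x (f x * avg a b i g x).
Proof.
move=> fp gp; have mf := Lfun_measurable fp; have mg := Lfun_measurable gp.
have [afp _ _] := Lp_linear_avg i (leey 1%E).
have int h : h \in Lfun mu +oo%E -> mu.-integrable setT (EFin \o h).
  by move=> hp; exact: (Lfun_integrable1 (leey 1%E) hp).
have := Lfun_inftyM (afp f fp) gp; have := Lfun_inftyM (afp g gp) fp.
rewrite !avgE// => gfp fgp.
by apply: (@average_self_adjoint _ _ _ _ _ mu (P i) _ (mPhi i) (@PhiE i)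
  (@insert_coordK R d i)); exact: int.
Qed.

(** The weak derivative of f in direction j may be tested against functions that
are test functions in all coordinates but the i-th and constant in the i-th:
multiply by a cutoff of the i-th coordinate, on which the j-th derivative does
not act, and let the cutoff tend to 1. *)
Lemma weak_partial_fibre i j f g (s : R) : j != i ->
  f \in Lfun mu +oo%E -> g \in Lfun mu +oo%E -> weak_partial a b j f g ->
  forall psi, test_function a b psi ->
  \int[mu]_x (f x * partial j psi (set_coord x i s)) =
  - \int[mu]_x (g x * psi (set_coord x i s)).
Proof.
move=> ji fp gp fg psi tpsi; have [spsi _ _] := tpsi.
pose chi k (x : 'rV[R]_d) := cutoff (a i) (b i) k (x ord0 i).
have cchi k : continuous (chi k).
  exact/continuous_comp_coord/flat_generated_continuous/cutoff_generated.
have cut u v : u \in Lfun mu +oo%E -> continuous v ->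
    \int[mu]_x (u x * v (set_coord x i s) * chi k x) @[k --> \oo] -->
    \int[mu]_x (u x * v (set_coord x i s)).
  move=> up cv; apply: (@cvg_Rintegral_multiplier _ _ _ mu
    (fun x => u x * v (set_coord x i s)) chi).
  - apply: Lfun_integrable1 (leey 1%E) _; apply: Lfun_inftyM => //.
    exact/Lfun_infty_continuous/continuous_comp_set_coord.
  - by move=> k; apply: continuous_measurable_rV; exact: cchi.
  - by move=> k x; rewrite cutoff_ge0 cutoff_le1.
  - by apply: filterS ae_interior_box => x /interior_boxP/(_ i) /cutoff_cvg1.
have c1 := cut f _ fp (spsi [:: j]).1.
have c2 := cvgN (cut g _ gp (spsi [::]).1).
rewrite [X in X @ _ --> _](_ : _ =
    - (fun k => \int[mu]_x (g x * psi (set_coord x i s) * chi k x))) in c1.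
  exact: (cvg_unique (@Rhausdorff R) c1 (c2 _)).
apply/funext => k; have := fg _ (test_function_cutoff i s k tpsi).
under eq_Rintegral do rewrite (partial_cutoff a b s k _ ji spsi) mulrA.
by move=> -> /=; rewrite fctE; congr (- _); apply: eq_Rintegral => x _; exact: mulrA.
Qed.

(** The weak partial derivatives of the average are the averages of the weak
partial derivatives, except for the one in direction i, which is 0. *)
Lemma W1oo_avg i f : W1oo a b f -> W1oo a b (avg a b i f).
Proof.
move=> [fp fW]; have [afp _ _] := Lp_linear_avg i (leey 1%E); split; first exact: afp.
move=> j; have [g gp' fg] := fW j; have gp : g \in Lfun mu +oo%E := gp'.
have [->|ji] := eqVneq j i.
  exists (cst 0) => [|psi tpsi].
    by apply: Lfun_infty_continuous; exact: cst_continuous.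
  have [_ pp] := Lfun_infty_test tpsi.
  rewrite [LHS](Rintegral_avg_sym i fp (pp i)).
  under eq_Rintegral do rewrite /avg (integral_partial_fibre _ (hab i) tpsi) !mulr0.
  under [in RHS]eq_Rintegral do rewrite mul0r.
  by rewrite Rintegral_cst// !mul0r oppr0.
exists (avg a b i g) => [|psi tpsi]; first exact: afp.
have [spsi _ _] := tpsi; have [psip /(_ j) pp] := Lfun_infty_test tpsi.
have oppE v : v \in Lfun mu +oo%E ->
    - (\int[mu]_x (g x * v x)) = \int[mu]_x ((- g x) * v x).
  move=> vp; rewrite -mulN1r -RintegralZl//.
    by apply: eq_Rintegral => x _; rewrite mulN1r mulNr.
  exact: (Lfun_integrable1 (leey 1%E) (Lfun_inftyM gp vp)).
have Ngp : (fun x => - g x) \in Lfun mu +oo%E.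
  exact: (@Lfun_oppr_closed _ _ _ mu +oo%E g gp).
rewrite [LHS](Rintegral_avg_sym i fp pp) [X in - X](Rintegral_avg_sym i gp psip).
(* The sign is moved to g, so that Fubini's theorem applies to the right-hand
   side as a whole. *)
rewrite [RHS]oppE; last exact: afp.
rewrite (@avgE i _ (Lfun_measurable pp)) (@avgE i _ (Lfun_measurable psip)).
rewrite !(@Rintegral_mul_average _ _ _ _ _ mu (P i) _ (mPhi i) (@PhiE i))//.
apply: eq_Rintegral => t _; rewrite -(oppE (fun x => psi (set_coord x i t))).
  exact: (weak_partial_fibre t ji fp gp fg tpsi).
exact/Lfun_infty_continuous/continuous_comp_set_coord/(spsi [::]).1.
Qed.

Lemma W1ooB f g : W1oo a b f -> W1oo a b g -> W1oo a b (fun x => f x - g x).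
Proof.
move=> [fp fW] [gp gW]; split=> [|i]; first exact: (LfunB (leey 1%E)).
have [f' f'p ff'] := fW i; have [g' g'p gg'] := gW i.
exists (fun x => f' x - g' x) => [|psi tpsi]; first exact: (LfunB (leey 1%E)).
have [psip /(_ i) pp] := Lfun_infty_test tpsi.
rewrite [LHS](@RintegralM_sub _ _ _ mu _ _ _ fp gp pp).
rewrite [X in _ = - X](@RintegralM_sub _ _ _ mu _ _ _ f'p g'p psip).
rewrite [X in X - _ = _](ff' _ tpsi) [X in _ - X = _](gg' _ tpsi).
by rewrite opprB opprK addrC.
Qed.

Lemma W1oo_calP (I : {set 'I_d}) f : W1oo a b f -> W1oo a b (calP a b I f).
Proof.
move=> fW; rewrite calPE; elim: [seq _ <- _ | _] => [|i r IH].
  by rewrite /residuals big_nil.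
by rewrite residuals_cons; apply: W1ooB => //; exact: W1oo_avg.
Qed.

End coordinate_averages.

Theorem proposition2p1 (R : realType) (d : nat) (hd : (0 < d)%N)
    (a b : 'I_d -> R) (hab : forall i, a i < b i) (I : {set 'I_d}) :
  (* the averages are linear contractions on every L^p(S) *)
  (forall p : \bar R, (1 <= p)%E -> forall i : 'I_d,
    [/\ Lp_linear (box_measure a b) p (avg a b i),
        Lp_bounded (box_measure a b) p (avg a b i)
      & Lp_contraction (box_measure a b) p (avg a b i)]) /\
  (* they are idempotent and commute *)
  (forall p : \bar R, (1 <= p)%E -> forall f, f \in Lfun (box_measure a b) p ->
    (forall i : 'I_d,
      avg a b i (avg a b i f) = avg a b i f %[ae box_measure a b]) /\
    (forall i j : 'I_d,
      avg a b i (avg a b j f) = avg a b j (avg a b i f)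
        %[ae box_measure a b])) /\
  (* P_I and R_I are bounded linear projections on every L^p(S) *)
  (forall p : \bar R, (1 <= p)%E ->
    Lp_projection (box_measure a b) p (calP a b I) /\
    Lp_projection (box_measure a b) p (calR a b I)) /\
  (* P_I R_I = R_I P_I = 0 *)
  (forall p : \bar R, (1 <= p)%E -> forall f, f \in Lfun (box_measure a b) p ->
    calP a b I (calR a b I f) = cst 0 %[ae box_measure a b] /\
    calR a b I (calP a b I f) = cst 0 %[ae box_measure a b]) /\
  (* Pi_i P_I = 0 for i in I *)
  (forall p : \bar R, (1 <= p)%E -> forall i : 'I_d, i \in I ->
    forall f, f \in Lfun (box_measure a b) p ->
      avg a b i (calP a b I f) = cst 0 %[ae box_measure a b]) /\
  (* hence P_I f is centered on I *)
  (I != finset.set0 -> forall f, f \in Lfun (box_measure a b) 1%E ->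
    centered a b I (calP a b I f)) /\
  (* R_I f = 0 iff f is centered on I *)
  (I != finset.set0 -> forall f, f \in Lfun (box_measure a b) 1%E ->
    (calR a b I f = cst 0 %[ae box_measure a b] <-> centered a b I f)) /\
  (* preservation of W^{1,oo}(S) *)
  (forall f, W1oo a b f -> W1oo a b (calP a b I f) /\ W1oo a b (calR a b I f)).
Proof.
set mu := fin_box_measure hab.
have lin p p1 i : Lp_linear mu p (avg a b i) := Lp_linear_avg hab i p1.
have bnd p p1 i : Lp_bounded mu p (avg a b i) := Lp_bounded_avg hab i p1.
have idem p (p1 : (1 <= p)%E) i : Lp_idempotent mu p (avg a b i).
  by move=> f fp; rewrite (avgK i p1 fp); exact: aeW.
have comm p (p1 : (1 <= p)%E) i j f (fp : f \in Lfun mu p) := avgC i j p1 fp.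
have memI i : (i \in [seq i <- index_enum 'I_d | i \in I]) = (i \in I).
  by rewrite mem_filter mem_index_enum andbT.
have PE f : calP a b I f = residuals (avg a b) [seq i <- index_enum 'I_d | i \in I] f.
  by rewrite calPE.
split; [|split; [|split; [|split; [|split; [|split; [|split]]]]]].
- move=> p p1 i; split; [exact: lin|exact: bnd|].
  exact: (@Lp_contraction_avg R d a b hab p i p1).
- move=> p p1 f fp; split => [i|i j]; first exact: (idem p p1 i f fp).
  exact: comm fp.
- move=> p p1; rewrite /calR calPE; split.
    exact: (Lp_projection_residuals p1 (lin p p1) (bnd p p1) (idem p p1) (comm p p1)).
  exact: (Lp_projection_compl_residuals p1 (lin p p1) (bnd p p1) (idem p p1) (comm p p1)).
- move=> p p1 f fp; rewrite /calR !PE; split.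
    exact: (residuals_compl p1 (lin p p1) (idem p p1) (comm p p1) _ fp).
  exact: (compl_residuals p1 (lin p p1) (idem p p1) (comm p p1) _ fp).
- move=> p p1 i iI f fp; rewrite PE.
  by apply: (average_residuals p1 (lin p p1) (idem p p1) (comm p p1) _ fp); rewrite memI.
- move=> _ f fp i iI; split.
    rewrite PE; have [Pp _ _] := Lp_linear_residuals (lexx 1%E) (lin _ (lexx 1%E))
      [seq i <- index_enum 'I_d | i \in I].
    exact: Pp.
  rewrite PE; apply: (average_residuals (lexx 1%E) (lin _ (lexx _)) (idem _ (lexx _))
    (comm _ (lexx _)) _ fp).
  by rewrite memI.
- move=> _ f fp; rewrite /calR PE.
  rewrite (compl_residuals_eq0P (lexx 1%E) (lin _ (lexx _)) (idem _ (lexx _))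
    (comm _ (lexx _)) _ fp).
  split => [f0 i iI|fc i]; first by split => //; apply: f0; rewrite memI.
  by rewrite memI => /fc[].
- move=> f fW; have PW := W1oo_calP hab I fW; split => //.
  exact: W1ooB.
Qed.
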